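(* Let $A\in\mathbb{R}^{m\times n}$, $b\in\mathbb{R}^m$, $f(x)=\frac12\|Ax-b\|^2$, $\lambda>0$, $q\in[0,1)$, $F(x)=f(x)+\lambda\|x\|_q^q$. Let $\{x^k\}$ be the sequence generated by algorithm PSNP or PCSNP with $\alpha_k\equiv\alpha\in\left(0,\min\{\tau,\frac{1}{\sigma+\sigma_0}\}\right]$, let $x^*$ be an accumulation point of $\{x^k\}$, and $S^*:=\mathrm{supp}(x^* )$. Suppose $\langle M^*v,v\rangle>0$ for all $M^*\in\partial^2_{S^*}E(x^* )$ and all nonzero $v\in\mathbb{R}^{|S^*|}$, and $\sigma\in(0,\sigma_* )$, where $\sigma_*:=\frac12\inf_{M^*\in\partial^2_{S^*}E(x^* )}\inf_{\|v\|=1}\langle M^*v,v\rangle$. Then the whole sequence converges to $x^*$, which is a unique local minimizer of $F$. Moreover: 1) if $q=0$, the sequence converges within finitely many steps (i.e. $x^k=x^*$ for all sufficiently large $k$); 2) if $q\in(0,1)$, the sequence converges quadratically, i.e. $\|x^{k+1}-x^*\|=O(\|x^k-x^*\|^2)$.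
   Context: $\|x\|_q^q:=\sum_i|x_i|^q$, where $|t|^0=1$ for $t\ne0$ and $|0|^0=0$. $\|\cdot\|$ is the Euclidean norm. $\mathrm{supp}(x)$ is the set of indices of nonzero entries; $x_T$ denotes the sub-vector indexed by $T$, $H_T$ the principal sub-matrix indexed by $T$, $\overline T$ the complement of $T$. $\sigma_0>0$ is a constant such that $f$ is $\sigma_0$-strongly smooth, i.e. $f(x)\le f(w)+\langle\nabla f(w),x-w\rangle+\frac{\sigma_0}2\|x-w\|^2$ for all $x,w\in\mathbb{R}^n$; $\tau>0$ is a given constant. Generalized Hessian: $\partial^2 g(x)$ is the convex hull of all $H=\lim\nabla^2g(x^i)$ over sequences $x^i\to x$ of points at which $g$ is twice differentiable. $E(x;T):=f(x)+\lambda\|x_T\|_q^q$; for $S=\mathrm{supp}(x)$, $\nabla_SE(x):=(\nabla E(\cdot;S)(x))_S$ and $\partial^2_SE(x):=\{M_S:M\in\partial^2E(\cdot;S)(x)\}$. Unique local minimizer means: there are $\eta_*>0$ and a neighbourhood of $x^*$ on which $F(x)\ge F(x^* )+\eta_*\|x-x^*\|^2$. $\mathrm{Prox}_{r}(z):=\operatorname{argmin}_{w}\frac12\|z-w\|^2+r(w)$ (set of global minimizers). Algorithm PSNP: given $x^0\in\mathbb{R}^n$, $\sigma>0$, $\gamma\in(0,1)$, for $k=0,1,2,\dots$: (i) take $w^k\in\mathrm{Prox}_{\alpha_k\lambda\|\cdot\|_q^q}(x^k-\alpha_k\nabla f(x^k))$ and set $S^k=\mathrm{supp}(w^k)$; the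 step $\alpha_k$ is to be such that $F(w^k)\le F(x^k)-\frac\sigma4\|w^k-x^k\|^2$ (this holds for the choice of $\alpha_k$ above); (ii) choose $M^k\in\partial^2_{S^k}E(w^k)$; if the equations $M^kd^k_{S^k}=\nabla_{S^k}E(w^k)$, $d^k_{\overline{S^k}}=0$ have a solution $d^k$ and there is an integer $s\in\{0,1,2,\dots\}$ with $F(w^k-\gamma^{s}d^k)\le F(w^k)-\frac\sigma2\|\gamma^{s}d^k\|^2$, let $s_k$ be the smallest such integer, set $\beta_k=\gamma^{s_k}$ and $x^{k+1}=w^k-\beta_kd^k$; otherwise set $x^{k+1}=w^k$. Algorithm PCSNP is the same except that step (ii) is tried only when $S^k=\mathrm{supp}(x^k)$; otherwise $x^{k+1}=w^k$. Standing assumption: $\nabla f(0)\neq0$ and $\lambda<\frac{\alpha^{1-q}}{2}\|\nabla f(0)\|_\infty^{2-q}$. *)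

(* Defs.v *)
From HB Require Import structures.
From mathcomp Require Export all_boot all_order all_algebra.
From mathcomp Require Export all_classical all_reals all_analysis.
Set Implicit Arguments.
Unset Strict Implicit.
Unset Printing Implicit Defensive.
Import Order.TTheory GRing.Theory Num.Theory.
Import numFieldNormedType.Exports.
Local Open Scope classical_set_scope.
Local Open Scope ring_scope.

(* Vectors of R^n are column vectors 'cV[R]_n.  The library norm `|x| on them is
   the max norm; it induces the usual topology and differential calculus, but
   the Euclidean norm has to be defined separately. *)

Section Vectors.
Variable R : realType.

Definition dotp n (x y : 'cV[R]_n) : R := \sum_i x i 0 * y i 0.

Definition enorm n (x : 'cV[R]_n) : R := Num.sqrt (dotp x x).

(* The library's powR has 0 `^ 0 = 1, whereas here |0|^0 = 0. *)
Definition abspow (q t : R) : R := if t == 0 then 0 else `|t| `^ q.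

(* ||x||_q^q *)
Definition qnorm n (q : R) (x : 'cV[R]_n) : R := \sum_i abspow q (x i 0).

Definition supp n (x : 'cV[R]_n) : {set 'I_n} := [set i | x i 0 != 0]%SET.

(* x_T and H_T, with the indices in T listed in increasing order *)
Definition subvec n (T : {set 'I_n}) (x : 'cV[R]_n) : 'cV[R]_#|T| :=
  rowsub (@enum_val _ (mem T)) x.

Definition submat n (T : {set 'I_n}) (H : 'M[R]_n) : 'M[R]_#|T| :=
  mxsub (@enum_val _ (mem T)) (@enum_val _ (mem T)) H.

End Vectors.

Section Calculus.
Variables (R : realType) (n : nat).
Implicit Types (g : 'cV[R]_n -> R) (x : 'cV[R]_n).

Definition grad g x : 'cV[R]_n := \col_i 'D_(delta_mx i 0) g x.

Definition twice_differentiable g x : Prop :=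
  (\forall y \near x, differentiable g y) /\ differentiable (grad g) x.

Definition hess g x : 'M[R]_n :=
  \matrix_(i, j) 'D_(delta_mx j 0) (fun y => grad g y i 0) x.

Definition convex_hull (M : lmodType R) (A : set M) : set M :=
  smallest (@convex_set R M) A.

Definition gen_hess g x : set 'M[R]_n :=
  convex_hull [set H : 'M[R]_n | exists xs : nat -> 'cV[R]_n,
    [/\ forall i, twice_differentiable g (xs i),
        xs i @[i --> \oo] --> x &
        hess g (xs i) @[i --> \oo] --> H]].

Definition strongly_smooth (s : R) g : Prop :=
  forall x w, g x <= g w + dotp (grad g w) (x - w) + s / 2 * enorm (x - w) ^+ 2.

Definition Prox (r : 'cV[R]_n -> R) (z : 'cV[R]_n) : set 'cV[R]_n :=
  [set w | forall v, 2^-1 * enorm (z - w) ^+ 2 + r w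
                  <= 2^-1 * enorm (z - v) ^+ 2 + r v].

End Calculus.

Section Algorithms.
Variables (R : realType) (n : nat) (f : 'cV[R]_n -> R) (lambda q : R).
Implicit Types (x w d : 'cV[R]_n) (T : {set 'I_n}).

Definition F x : R := f x + lambda * qnorm q x.

Definition E T x : R := f x + lambda * qnorm q (subvec T x).

(* nabla_S E(x) and partial^2_S E(x), always with S = supp(x) *)
Definition gradS x : 'cV[R]_#|supp x| := subvec (supp x) (grad (E (supp x)) x).

Definition gen_hessS x : set 'M[R]_#|supp x| :=
  submat (supp x) @` gen_hess (E (supp x)) x.
Arguments gen_hessS : clear implicits.

Definition prox_step (alpha sigma : R) x w : Prop :=
  Prox (fun v => alpha * lambda * qnorm q v) (x - alpha *: grad f x) w /\
  F w <= F x - sigma / 4 * enorm (w - x) ^+ 2.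

Definition newton_direction w (M : 'M[R]_#|supp w|) d : Prop :=
  M *m subvec (supp w) d = gradS w /\ subvec (~: supp w) d = 0.
Arguments newton_direction : clear implicits.

Definition sufficient_decrease (sigma gamma : R) w d (s : nat) : Prop :=
  F (w - gamma ^+ s *: d)
    <= F w - sigma / 2 * enorm (gamma ^+ s *: d) ^+ 2.

(* The matrix M and the solution d of the Newton equations are arbitrary; the
   step falls back to w when there is no solution, or when no s is admissible
   for the solution d that has been picked. *)
Definition newton_step (sigma gamma : R) w x' : Prop :=
  exists2 M, gen_hessS w M &
    [\/ exists d s,
          [/\ newton_direction w M d, sufficient_decrease sigma gamma w d s,
              forall s', sufficient_decrease sigma gamma w d s' -> (s <= s')%N
            & x' = w - gamma ^+ s *: d],
        (forall d, ~ newton_direction w M d) /\ x' = w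
      | exists d,
          [/\ newton_direction w M d,
              forall s, ~ sufficient_decrease sigma gamma w d s
            & x' = w]].

Definition PSNP (sigma gamma : R) (alpha : nat -> R) (x : nat -> 'cV[R]_n) :=
  forall k, exists2 w, prox_step (alpha k) sigma (x k) w &
    newton_step sigma gamma w (x k.+1).

Definition PCSNP (sigma gamma : R) (alpha : nat -> R) (x : nat -> 'cV[R]_n) :=
  forall k, exists2 w, prox_step (alpha k) sigma (x k) w &
    if supp w == supp (x k) then newton_step sigma gamma w (x k.+1)
    else x k.+1 = w.

Definition unique_local_minimizer (xstar : 'cV[R]_n) : Prop :=
  exists2 eta : R, 0 < eta &
    \forall x \near xstar, F xstar + eta * enorm (x - xstar) ^+ 2 <= F x.

(* Extended-real valued: the infimum over an empty set is +oo. *)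
Definition sigma_star (xstar : 'cV[R]_n) : \bar R :=
  ((2^-1)%:E * ereal_inf
    [set ereal_inf [set (dotp (M *m v) v)%:E
                   | v in [set v : 'cV[R]_#|supp xstar| | enorm v = 1%R]]
    | M in gen_hessS xstar])%E.

End Algorithms.

Arguments gen_hessS {R n} f lambda q x _.
Arguments newton_direction {R n} f lambda q w M d.

Definition lsq (R : realType) m n (A : 'M[R]_(m, n)) (b : 'cV[R]_m)
    (x : 'cV[R]_n) : R := 2^-1 * enorm (A *m x - b) ^+ 2.

(* Main.v *)
(* Let T be the support of xstar and c the Lipschitz constant of the Hessian of
   F on the vectors supported on T near xstar, where F is smooth: there the
   nonzero entries stay away from 0.  The proximal points have entries that are
   either 0 or bounded below, so near xstar they are supported exactly on T;
   passing to the limit in their optimality condition shows that the gradient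
   of F on T vanishes at xstar.  As the Hessian on T is at least 2 sigma,
   (sigma / 2) |y - xstar|^2 <= F y - F xstar <= C |y - xstar|^2 for y supported
   on T.  The values F (x k) decrease to F xstar and the steps vanish, so the
   lower bound traps the iterates near xstar.  From then on the full Newton step
   satisfies the decrease condition, hence s = 0 is chosen and
   |x k.+1 - xstar| <= C' c |w k - xstar|^2; the two bounds above turn
   |w k - xstar|^2 into |x k - xstar|^2 because F (w k) <= F (x k).  For q = 0
   the Hessian is constant, c = 0, and the Newton step lands on xstar. *)
From mathcomp Require Import ring lra.
Require Import Defs.
Import Order.TTheory GRing.Theory Num.Theory.
Import numFieldNormedType.Exports.
Set Implicit Arguments.
Unset Strict Implicit.
Unset Printing Implicit Defensive.
Local Open Scope classical_set_scope.
Local Open Scope ring_scope.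

(** * Taylor bounds for |t|^q away from 0 *)

Section ScalarPower.
Variable R : realType.
Implicit Types (q r s t u K : R).

(** Differentiability is asked only between [s] and [t], which the applications choose on one side
    of 0, where the power is smooth. The minimum and maximum make the bound symmetric in the
    endpoints. *)
Lemma mean_value_bound (f df : R -> R) s t K :
  (forall u, Num.min s t <= u <= Num.max s t -> is_derive u 1 f (df u)) ->
  (forall u, Num.min s t <= u <= Num.max s t -> `|df u| <= K) ->
  `|f s - f t| <= K * `|s - t|.
Proof.
wlog st : s t / s < t.
  move=> H hd hK; case: (ltgtP s t) => [st|ts|<-]; first exact: H.
    rewrite distrC [X in _ * X]distrC; apply: H => // u; rewrite minC maxC.
      exact: hd.
    exact: hK.
  by rewrite !subrr normr0 mulr0.
rewrite min_l ?max_r ?(ltW st) // => hd hK.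
have [|||c cst e] := @MVT R f df s t.
- exact: st.
- by move=> u; rewrite in_itv /= => /andP[? ?]; apply: hd; rewrite !ltW.
- apply: derivable_within_continuous => u; rewrite in_itv /= => us.
  by have [] := hd _ us.
rewrite distrC e normrM [`|s - t|]distrC ler_wpM2r //; apply: hK.
by move: cst; rewrite in_itv /= => /andP[? ?]; rewrite !ltW.
Qed.

(** The sign factor makes this odd, so one formula gives the derivative on both half-lines. *)
Definition dabspow q t : R := q * Num.sg t * `|t| `^ (q - 1).

Definition ddabspow q t : R := q * (q - 1) * `|t| `^ (q - 2).

(** Bound on the third derivative of the power at distance at least [r] from 0, for [q < 1]: the
    exponent [q - 3] is negative, so the worst case is at [r]. The factor [q] makes it vanish for
    [q = 0]. *)
Definition abspow_cst q r : R := `|q * (q - 1) * (q - 2)| * r `^ (q - 3).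

Lemma abspow_gt0 q t : 0 < t -> abspow q t = t `^ q.
Proof. by move=> t0; rewrite /abspow gt_eqF // gtr0_norm. Qed.

Lemma dabspow_gt0 q t : 0 < t -> dabspow q t = q * t `^ (q - 1).
Proof. by move=> t0; rewrite /dabspow gtr0_sg // gtr0_norm // mulr1. Qed.

Lemma abspowN q t : abspow q (- t) = abspow q t.
Proof. by rewrite /abspow oppr_eq0 normrN. Qed.

Lemma dabspowN q t : dabspow q (- t) = - dabspow q t.
Proof. by rewrite /dabspow sgrN normrN mulrN mulNr. Qed.

Lemma ddabspowN q t : ddabspow q (- t) = ddabspow q t.
Proof. by rewrite /ddabspow normrN. Qed.

Lemma abspow_ge0 q t : 0 <= abspow q t.
Proof. by rewrite /abspow; case: ifP => // _; exact: powR_ge0. Qed.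

Lemma abspow0 q : abspow q 0 = 0.
Proof. by rewrite /abspow eqxx. Qed.

Lemma abspow_cst_ge0 q r : 0 <= abspow_cst q r.
Proof. by rewrite /abspow_cst mulr_ge0 // powR_ge0. Qed.

Lemma ddabspow_le0 q t : 0 <= q < 1 -> ddabspow q t <= 0.
Proof.
case/andP=> q0 q1; rewrite /ddabspow; apply: mulr_le0_ge0; last exact: powR_ge0.
by apply: mulr_ge0_le0 => //; lra.
Qed.

Lemma powR_nincr p s t : p <= 0 -> 0 < s -> s <= t -> t `^ p <= s `^ p.
Proof.
move=> p0 s0 st; have t0 : 0 < t by exact: lt_le_trans st.
rewrite -[p]opprK [leLHS]powRN [leRHS]powRN lef_pV2 ?posrE ?powR_gt0 //.
by rewrite ge0_ler_powR ?oppr_ge0 // nnegrE ltW.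
Qed.

Lemma is_derive_cMpowR (c p u df : R) : 0 < u -> c * (p * u `^ (p - 1)) = df ->
  is_derive u (1 : R) (fun x => c * x `^ p) df.
Proof.
move=> u0 <-; have h := is_derive1_powR p u0.
exact: (is_deriveZ c h).
Qed.

Lemma between_ge r s t u : r <= s -> r <= t ->
  Num.min s t <= u <= Num.max s t -> r <= u.
Proof.
move=> rs rt /andP[+ _]; apply: le_trans.
by rewrite le_min rs.
Qed.

Lemma between_dist s t u : Num.min s t <= u <= Num.max s t -> `|u - t| <= `|s - t|.
Proof.
by case: (leP s t) => st /andP[? ?]; rewrite ler_norml;
  [rewrite ler0_norm|rewrite gtr0_norm]; lra.
Qed.

Lemma ddabspow_lipschitz_pos q r s t : 0 <= q < 1 -> 0 < r -> r <= s -> r <= t ->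
  `|ddabspow q s - ddabspow q t| <= abspow_cst q r * `|s - t|.
Proof.
move=> /andP[q0 q1] r0 rs rt.
have s0 := lt_le_trans r0 rs; have t0 := lt_le_trans r0 rt.
rewrite /ddabspow (gtr0_norm s0) (gtr0_norm t0).
pose f u := q * (q - 1) * u `^ (q - 2).
apply: (@mean_value_bound f (fun u => q * (q - 1) * (q - 2) * u `^ (q - 3))).
  move=> u /(between_ge rs rt) ru; have u0 := lt_le_trans r0 ru.
  apply: is_derive_cMpowR => //; rewrite mulrA; congr (_ * _ `^ _); lra.
move=> u /(between_ge rs rt) ru; have u0 := lt_le_trans r0 ru.
rewrite normrM ler_wpM2l // ger0_norm ?powR_ge0 // powR_nincr //; lra.
Qed.

(** The remainder, as a function of [s], has derivative [ddabspow q u - ddabspow q t], which the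
    Lipschitz bound controls. The same argument one order higher gives [abspow_taylor_pos]. *)
Lemma dabspow_taylor_pos q r s t : 0 <= q < 1 -> 0 < r -> r <= s -> r <= t ->
  `|dabspow q s - dabspow q t - ddabspow q t * (s - t)|
    <= abspow_cst q r * (s - t) ^+ 2.
Proof.
move=> hq r0 rs rt.
have s0 := lt_le_trans r0 rs; have t0 := lt_le_trans r0 rt.
rewrite !dabspow_gt0 //.
pose f u := q * u `^ (q - 1) - ddabspow q t * (u - t).
have -> : q * s `^ (q - 1) - q * t `^ (q - 1) - ddabspow q t * (s - t) = f s - f t.
  by rewrite /f; ring.
rewrite -real_normK ?num_real // expr2 mulrA.
apply: (@mean_value_bound f (fun u => ddabspow q u - ddabspow q t)).
  move=> u /(between_ge rs rt) ru; have u0 := lt_le_trans r0 ru.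
  apply: is_deriveB.
    apply: is_derive_cMpowR => //; rewrite mulrA /ddabspow gtr0_norm //.
    by congr (_ * _ `^ _); lra.
  apply: is_derive_eq.
  by rewrite subr0 /GRing.scale /= mulr1.
move=> u ust; have ru := between_ge rs rt ust.
apply: le_trans (ddabspow_lipschitz_pos hq r0 ru rt) _.
by rewrite ler_wpM2l ?abspow_cst_ge0 // between_dist.
Qed.

Lemma abspow_taylor_pos q r s t : 0 <= q < 1 -> 0 < r -> r <= s -> r <= t ->
  `|abspow q s - abspow q t - dabspow q t * (s - t)
      - ddabspow q t / 2 * (s - t) ^+ 2|
    <= abspow_cst q r * `|s - t| ^+ 3.
Proof.
move=> hq r0 rs rt.
have s0 := lt_le_trans r0 rs; have t0 := lt_le_trans r0 rt.
rewrite !abspow_gt0 //.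
pose f u := u `^ q - dabspow q t * (u - t) - ddabspow q t / 2 * (u - t) ^+ 2.
set l := (X in `|X|); have -> : l = f s - f t by rewrite /l /f; ring.
rewrite exprSr mulrA.
apply: (@mean_value_bound f (fun u => dabspow q u - dabspow q t
  - ddabspow q t * (u - t))).
  move=> u /(between_ge rs rt) ru; have u0 := lt_le_trans r0 ru.
  rewrite (dabspow_gt0 q u0).
  apply: is_deriveB; first apply: is_deriveB.
    exact: is_derive1_powR.
    apply: is_derive_eq.
    by rewrite subr0 /GRing.scale /= mulr1.
  apply: is_derive_eq.
  by rewrite subr0 /GRing.scale /= mulr1; field.
move=> u ust; have ru := between_ge rs rt ust.
apply: le_trans (dabspow_taylor_pos hq r0 ru rt) _.
rewrite ler_wpM2l ?abspow_cst_ge0 // -(@real_normK _ (u - t)) ?num_real //.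
by rewrite lerXn2r ?nnegrE ?normr_ge0 // between_dist.
Qed.

(** Points of opposite signs with modulus at least [r] are at least [2 * r] apart. Parity then
    reduces the Taylor bounds to the positive half-line. *)
Lemma same_side r s t : 0 < r -> r <= `|t| -> `|s - t| < r -> r <= `|s| ->
  (r <= s /\ r <= t) \/ (r <= - s /\ r <= - t).
Proof.
move=> r0 + /ltr_normlP[? ?]; rewrite !ler_normr => /orP[rt|rt] /orP[rs|rs].
- by left; split.
- by lra.
- by lra.
- by right; split.
Qed.

Lemma ddabspow_lipschitz q r s t : 0 <= q < 1 -> 0 < r ->
  r <= `|t| -> `|s - t| < r -> r <= `|s| ->
  `|ddabspow q s - ddabspow q t| <= abspow_cst q r * `|s - t|.
Proof.
move=> hq r0 rt st rs; case: (same_side r0 rt st rs) => -[hs ht].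
  exact: ddabspow_lipschitz_pos.
have := ddabspow_lipschitz_pos hq r0 hs ht.
by rewrite !ddabspowN -opprD normrN.
Qed.

Lemma dabspow_taylor q r s t : 0 <= q < 1 -> 0 < r ->
  r <= `|t| -> `|s - t| < r -> r <= `|s| ->
  `|dabspow q s - dabspow q t - ddabspow q t * (s - t)|
    <= abspow_cst q r * (s - t) ^+ 2.
Proof.
move=> hq r0 rt st rs; case: (same_side r0 rt st rs) => -[hs ht].
  exact: dabspow_taylor_pos.
have := dabspow_taylor_pos hq r0 hs ht.
rewrite !dabspowN ddabspowN -[leLHS]normrN.
by congr (`|_| <= _ * _); ring.
Qed.

Lemma abspow_taylor q r s t : 0 <= q < 1 -> 0 < r ->
  r <= `|t| -> `|s - t| < r -> r <= `|s| ->
  `|abspow q s - abspow q t - dabspow q t * (s - t)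
      - ddabspow q t / 2 * (s - t) ^+ 2|
    <= abspow_cst q r * `|s - t| ^+ 3.
Proof.
move=> hq r0 rt st rs; case: (same_side r0 rt st rs) => -[hs ht].
  exact: abspow_taylor_pos.
have := abspow_taylor_pos hq r0 hs ht.
rewrite !abspowN !dabspowN ddabspowN -[`|s - t|]normrN opprB.
rewrite [- s - - t](_ : _ = t - s); last by ring.
by congr (`|_| <= _); ring.
Qed.

Lemma is_derive_abspow q t : t != 0 -> is_derive t (1 : R) (abspow q) (dabspow q t).
Proof.
move=> tn0; case: (ltgtP t 0) tn0 => // t0 _.
  apply: (@near_eq_is_derive _ _ _ (fun u => (- u) `^ q)).
    near=> u; rewrite -abspowN abspow_gt0 // oppr_gt0.
    by near: u; exact: lt_nbhsl.
  have nt0 : 0 < - t by rewrite oppr_gt0.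
  have -> : dabspow q t = q * (- t) `^ (q - 1) * -1.
    by rewrite -[in LHS](opprK t) dabspowN dabspow_gt0 // mulrN1.
  have h : is_derive t (1 : R) ((fun u : R => u `^ q) \o (fun u => - u))
      (q * (- t) `^ (q - 1) * -1).
    by apply: is_derive1_comp; exact: is_derive1_powR.
  exact: h.
apply: (@near_eq_is_derive _ _ _ (fun u => u `^ q)).
  by near=> u; rewrite abspow_gt0 //; near: u; exact: lt_nbhsr.
by rewrite dabspow_gt0 //; exact: is_derive1_powR.
Unshelve. all: by end_near. Qed.

Lemma is_derive_dabspow q t : t != 0 ->
  is_derive t (1 : R) (dabspow q) (ddabspow q t).
Proof.
case: (ltgtP t 0) => // t0 _.
  apply: (@near_eq_is_derive _ _ _ (fun u => (- q) * (- u) `^ (q - 1))).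
    near=> u; rewrite -[in RHS](opprK u) dabspowN dabspow_gt0 ?mulNr // oppr_gt0.
    by near: u; exact: lt_nbhsl.
  have nt0 : 0 < - t by rewrite oppr_gt0.
  have -> : ddabspow q t = (- q) *: ((q - 1) * (- t) `^ (q - 1 - 1) * -1).
    rewrite -ddabspowN /ddabspow gtr0_norm // /GRing.scale /=.
    by rewrite (_ : q - 2 = q - 1 - 1); ring.
  apply: is_deriveZ.
  have h : is_derive t (1 : R) ((fun u : R => u `^ (q - 1)) \o (fun u => - u))
      ((q - 1) * (- t) `^ (q - 1 - 1) * -1).
    by apply: is_derive1_comp; exact: is_derive1_powR.
  exact: h.
apply: (@near_eq_is_derive _ _ _ (fun u => q * u `^ (q - 1))).
  by near=> u; rewrite dabspow_gt0 //; near: u; exact: lt_nbhsr.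
apply: is_derive_cMpowR => //; rewrite /ddabspow gtr0_norm // mulrA.
by congr (_ * _ `^ _); ring.
Unshelve. all: by end_near. Qed.

(** Away from 0, [ddabspow q] is a multiple of [abspow (q - 2)], which is differentiable there. *)
Lemma continuous_ddabspow q t : t != 0 -> {for t, continuous (ddabspow q)}.
Proof.
move=> tn0; have [dphi _] := is_derive_abspow (q - 2) tn0.
have dphi' : differentiable (abspow (q - 2)) t by apply/derivable1_diffP.
have ddE u : u != 0 -> ddabspow q u = q * (q - 1) * abspow (q - 2) u.
  by move=> /negbTE un0; rewrite /ddabspow /abspow un0.
have c : q * (q - 1) * abspow (q - 2) u @[u --> t] --> ddabspow q t.
  rewrite ddE //; apply: cvgM; first exact: cvg_cst.
  exact: differentiable_continuous.
apply: cvg_trans c; apply: near_eq_cvg.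
near=> u; rewrite ddE //; near: u.
exact: (cvgr_neq0 _ (@cvg_id _ (nbhs t))).
Unshelve. all: by end_near. Qed.

(** As [q < 1], the power beats every linear function near 0. This forces small entries of proximal
    points to be 0 and makes it costly to leave the support of the limit. *)
Lemma abspow_dominates q K : 0 <= q < 1 ->
  exists2 c, 0 < c & forall t, t != 0 -> `|t| < c -> K * `|t| < abspow q t.
Proof.
move=> /andP[q0 q1].
(* The maximum keeps the base positive for every [K]; the threshold below is the solution [c] of
   [K' * c^(1 - q) = 1]. *)
pose K' := Num.max 1 K; have K'0 : 0 < K' by rewrite lt_max ltr01.
exists (K' `^ (- (1 - q)^-1)); first exact: powR_gt0.
move=> t tn0 tc; have t0 : 0 < `|t| by rewrite normr_gt0.
rewrite /abspow (negbTE tn0).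
apply: (@le_lt_trans _ _ (K' * `|t|)).
  by rewrite ler_wpM2r // le_max lexx orbT.
have tE : `|t| = `|t| `^ (1 - q) * `|t| `^ q.
  rewrite -powRD ?subrK ?powRr1 //.
  by rewrite (gt_eqF t0) implybT.
rewrite [X in _ * X]tE mulrA gtr_pMl ?powR_gt0 //.
have q1' : 0 < 1 - q by rewrite subr_gt0.
rewrite -ltr_pdivlMl // mulr1.
have -> : K'^-1 = (K' `^ (- (1 - q)^-1)) `^ (1 - q).
  by rewrite -powRrM mulNr mulVf ?gt_eqF // powR_inv1 // ltW.
by rewrite gt0_ltr_powR // nnegrE ?powR_ge0.
Qed.
End ScalarPower.

(** * Differential calculus on column vectors *)

Section Differentiation.
Variables (R : realType) (V W : normedModType R).

(** The first-order expansion only sees values near [x], so [g] inherits it with the differential of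
    [f], and uniqueness identifies that map with the differential of [g]. *)
Lemma near_eq_differentiable (f g : V -> W) (x : V) :
  (\near x, f x = g x) -> differentiable f x -> differentiable g x.
Proof.
move=> fg df; have fgx : f x = g x := nbhs_singleton fg.
have dfc : continuous ('d f x) := diff_continuous df.
have /eqaddoP df0 := diff_locally df.
have dg : g \o shift x = cst (g x) + 'd f x +o_ 0 id.
  apply/eqaddoP => e e0; have := df0 _ e0.
  apply: filter_app.
  have : \forall h \near 0, f (h + x) = g (h + x).
    by move: fg; rewrite (near_shift 0 x) /=; apply: filterS => h /=; rewrite subr0.
  apply: filterS => h fgh.
  by rewrite !fctE /= fgh fgx.
have dgE : 'd g x = 'd f x :> (V -> W) := diff_unique dfc dg.
by apply/diff_locallyP; rewrite dgE.
Qed.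

Lemma differentiable_sum_pw n (f : 'I_n -> V -> W) (x : V) :
  (forall i, differentiable (f i) x) ->
  differentiable (fun y => \sum_i f i y) x.
Proof.
move=> df; rewrite (_ : (fun y => _) = \sum_i f i); last by rewrite fct_sumE.
exact: differentiable_sum.
Qed.

Lemma is_derive_sum_pw n (f : 'I_n -> V -> W) (x v : V) (df : 'I_n -> W) :
  (forall i, is_derive x v (f i) (df i)) ->
  is_derive x v (fun y => \sum_i f i y) (\sum_i df i).
Proof.
move=> df'; rewrite (_ : (fun y => _) = \sum_i f i); last by rewrite fct_sumE.
exact: is_derive_sum.
Qed.

Lemma is_derive_comp (f : V -> R) (g : R -> R) (x v : V) (a b : R) :
  is_derive (f x) (1 : R) g a -> differentiable f x -> is_derive x v f b ->
  is_derive x v (g \o f) (a * b).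
Proof.
move=> [dg <-] df [_ <-].
have dg' : differentiable g (f x) by apply/derivable1_diffP.
apply: DeriveDef; first exact/diff_derivable/differentiable_comp.
rewrite deriveE; last exact: differentiable_comp.
rewrite diff_comp //= deriveE // -[X in 'd g _ X]mulr1 linearZ /=.
by rewrite [in RHS]deriveE // mulrC.
Qed.

End Differentiation.

Section Coordinates.
Variables (R : realType) (n : nat).
Implicit Types (x v h : 'cV[R]_n).

Lemma is_derive_coord x v i : is_derive x v (fun y : 'cV[R]_n => y i 0) (v i 0).
Proof.
apply: DeriveDef; first exact/diff_derivable/differentiable_coord.
rewrite /derive; apply: cvg_lim => //.
apply: (@cvg_trans _ (cst (v i 0) @ 0^')); last exact: cvg_cst.
apply: near_eq_cvg; near=> h; rewrite /= !mxE addrK.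
rewrite /GRing.scale /= mulrA mulVf ?mul1r //.
by near: h; exact: nbhs_dnbhs_neq.
Unshelve. all: by end_near. Qed.

Lemma differentiable_col (f : 'I_n -> 'cV[R]_n -> R) x :
  (forall i, differentiable (f i) x) -> differentiable (fun y => \col_i f i y) x.
Proof.
move=> df.
rewrite (_ : (fun y => _) = fun y => \sum_i f i y *: (delta_mx i 0 : 'cV[R]_n)).
  by apply: differentiable_sum_pw => i; exact: differentiableZl.
apply/funext => y; apply/colP => j; rewrite mxE summxE (bigD1 j) //= !mxE.
rewrite !eqxx mulr1 big1 ?addr0 // => i ij.
by rewrite !mxE eq_sym (negbTE ij) mulr0.
Qed.

End Coordinates.

(** * Inner product, and comparison of the Euclidean norm with the max norm *)

Section Euclidean.
Variable R : realType.
Implicit Types n m : nat.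

Lemma dotpE n (x y : 'cV[R]_n) : dotp x y = (x^T *m y) 0 0.
Proof. by rewrite mxE; apply: eq_bigr => i _; rewrite mxE. Qed.

Lemma dotpC n (x y : 'cV[R]_n) : dotp x y = dotp y x.
Proof. by apply: eq_bigr => i _; rewrite mulrC. Qed.

Lemma dotpDl n (x y z : 'cV[R]_n) : dotp (x + y) z = dotp x z + dotp y z.
Proof. by rewrite -big_split; apply: eq_bigr => i _; rewrite mxE mulrDl. Qed.

Lemma dotpDr n (x y z : 'cV[R]_n) : dotp z (x + y) = dotp z x + dotp z y.
Proof. by rewrite dotpC dotpDl !(dotpC z). Qed.

Lemma dotpZl n a (x y : 'cV[R]_n) : dotp (a *: x) y = a * dotp x y.
Proof. by rewrite mulr_sumr; apply: eq_bigr => i _; rewrite mxE mulrA. Qed.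

Lemma dotpZr n a (x y : 'cV[R]_n) : dotp x (a *: y) = a * dotp x y.
Proof. by rewrite dotpC dotpZl dotpC. Qed.

Lemma dotpNl n (x y : 'cV[R]_n) : dotp (- x) y = - dotp x y.
Proof. by rewrite -scaleN1r dotpZl mulN1r. Qed.

Lemma dotpNr n (x y : 'cV[R]_n) : dotp x (- y) = - dotp x y.
Proof. by rewrite dotpC dotpNl dotpC. Qed.

Lemma dotp_sqrD n (x y : 'cV[R]_n) :
  dotp (x + y) (x + y) = dotp x x + 2 * dotp x y + dotp y y.
Proof. by rewrite dotpDl !dotpDr (dotpC y x); ring. Qed.

Lemma dotp_delta n (x : 'cV[R]_n) i : dotp x (delta_mx i 0) = x i 0.
Proof.
rewrite /dotp (bigD1 i) //= big1 => [|j ij].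
  by rewrite [delta_mx _ _ _ _]mxE !eqxx mulr1 addr0.
by rewrite [delta_mx _ _ _ _]mxE (negbTE ij) mulr0.
Qed.

Lemma dotp_trmx n m (A : 'M[R]_(m, n)) (u : 'cV[R]_m) (h : 'cV[R]_n) :
  dotp (A^T *m u) h = dotp u (A *m h).
Proof. by rewrite !dotpE trmx_mul trmxK mulmxA. Qed.

Lemma dotp_ge0 n (x : 'cV[R]_n) : 0 <= dotp x x.
Proof. by apply: sumr_ge0 => i _; rewrite -expr2 sqr_ge0. Qed.

Lemma sqr_enorm n (x : 'cV[R]_n) : enorm x ^+ 2 = dotp x x.
Proof. by rewrite sqr_sqrtr // dotp_ge0. Qed.

Lemma enorm_ge0 n (x : 'cV[R]_n) : 0 <= enorm x.
Proof. exact: sqrtr_ge0. Qed.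

Lemma coordN n (x : 'cV[R]_n) i : (- x) i 0 = - x i 0.
Proof. by rewrite mxE. Qed.

Lemma coordB n (x y : 'cV[R]_n) i : (x - y) i 0 = x i 0 - y i 0.
Proof. by rewrite !mxE. Qed.

Lemma coord_le_norm n (x : 'cV[R]_n) i : `|x i 0| <= `|x|.
Proof.
rewrite [leRHS]/Num.norm /= mx_normrE.
exact: (@le_bigmax _ _ _ _ (fun ij : 'I_n * 'I_1 => `|x ij.1 ij.2|) (i, 0)).
Qed.

Lemma sqr_coord_le_dotp n (x : 'cV[R]_n) i : x i 0 ^+ 2 <= dotp x x.
Proof.
rewrite /dotp (bigD1 i) //= -expr2 lerDl.
by apply: sumr_ge0 => j _; rewrite -expr2 sqr_ge0.
Qed.

Lemma norm_le n (x : 'cV[R]_n) c : 0 <= c -> (forall i, `|x i 0| <= c) -> `|x| <= c.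
Proof.
move=> c0 xc; rewrite [leLHS]/Num.norm /= mx_normrE.
by apply/bigmax_leP; split=> //= -[i j] _ /=; rewrite ord1.
Qed.

Lemma sqr_norm_le_dotp n (x : 'cV[R]_n) : `|x| ^+ 2 <= dotp x x.
Proof.
rewrite -sqr_enorm lerXn2r ?nnegrE ?normr_ge0 ?enorm_ge0 //.
apply: norm_le => [|i]; first exact: enorm_ge0.
by rewrite -sqrtr_sqr ler_wsqrtr // sqr_coord_le_dotp.
Qed.

Lemma dotp_le_sqr_norm n (x : 'cV[R]_n) : dotp x x <= n%:R * `|x| ^+ 2.
Proof.
rewrite mulr_natl -[X in _ *+ X]card_ord -sumr_const.
apply: ler_sum => i _; rewrite -expr2 -real_normK ?num_real //.
by rewrite lerXn2r ?nnegrE ?normr_ge0 // coord_le_norm.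
Qed.

Lemma norm_lt_dotp n (x : 'cV[R]_n) c : 0 < c -> dotp x x < c ^+ 2 -> `|x| < c.
Proof.
move=> c0 xc; rewrite -(@ltr_pXn2r _ 2) ?nnegrE ?normr_ge0 ?(ltW c0) //.
exact: le_lt_trans (sqr_norm_le_dotp x) xc.
Qed.

Lemma dotp_eq0 n (x : 'cV[R]_n) : (dotp x x == 0) = (x == 0).
Proof.
apply/idP/eqP => [/eqP x0|->]; last by rewrite /dotp big1 // => i _; rewrite mxE mul0r.
apply/eqP; rewrite -normr_eq0 -[_ == 0]andTb -(@expf_eq0 _ _ 2).
by rewrite eq_le sqr_ge0 andbT -x0 sqr_norm_le_dotp.
Qed.

Lemma mulmx_norm_bound m n (B : 'M[R]_(m, n)) :
  exists2 K, 0 <= K & forall (h : 'cV[R]_n) i, `|(B *m h) i 0| <= K * `|h|.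
Proof.
exists (\sum_(i < m) \sum_(j < n) `|B i j|) => [|h i].
  by apply: sumr_ge0 => i _; apply: sumr_ge0.
rewrite mxE; apply: le_trans (ler_norm_sum _ _ _) _.
rewrite mulr_suml (bigD1 i) //= mulr_suml -[leLHS]addr0.
apply: lerD.
  by apply: ler_sum => j _; rewrite normrM ler_wpM2l // coord_le_norm.
by apply: sumr_ge0 => k _; rewrite mulr_ge0 // sumr_ge0.
Qed.

End Euclidean.

(** * The least-squares term: expansion and gradient *)

Section LeastSquares.
Variables (R : realType) (m n : nat) (A : 'M[R]_(m, n)) (b : 'cV[R]_m).
Implicit Types (x y h v : 'cV[R]_n).

Definition lsq_grad y : 'cV[R]_n := A^T *m (A *m y - b).

Lemma lsq_dotp y : lsq A b y = 2^-1 * dotp (A *m y - b) (A *m y - b).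
Proof. by rewrite /lsq sqr_enorm. Qed.

Lemma lsq_ge0 y : 0 <= lsq A b y.
Proof. by rewrite lsq_dotp mulr_ge0 ?invr_ge0 ?ler0n // dotp_ge0. Qed.

(** The expansion is exact, so every Taylor remainder of F comes from the power terms alone. *)
Lemma lsqD y h : lsq A b (y + h) =
  lsq A b y + dotp (lsq_grad y) h + 2^-1 * dotp (A *m h) (A *m h).
Proof.
rewrite !lsq_dotp /lsq_grad dotp_trmx mulmxDr.
rewrite (_ : A *m y + A *m h - b = A *m y - b + A *m h); last by rewrite addrAC.
move: (A *m y - b) => r; rewrite dotpDl !dotpDr (dotpC (A *m h) r).
by field.
Qed.

Lemma lsq_gradD y h : lsq_grad (y + h) = lsq_grad y + A^T *m A *m h.
Proof.
rewrite /lsq_grad -mulmxA -mulmxDr; congr (_ *m _).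
by rewrite mulmxDr addrAC.
Qed.

Lemma differentiable_mulmx p (B : 'M[R]_(p, n)) (c : 'cV[R]_p) i y :
  differentiable (fun y => (B *m y - c) i 0) y.
Proof.
rewrite (_ : (fun y => _) = (fun y => \sum_j B i j *: y j 0) - cst (c i 0)).
  apply: differentiableB => //; apply: differentiable_sum_pw => j.
  exact/differentiableZ/differentiable_coord.
by apply/funext => z; rewrite !mxE.
Qed.

Lemma is_derive_mulmx p (B : 'M[R]_(p, n)) (c : 'cV[R]_p) i y v :
  is_derive y v (fun y => (B *m y - c) i 0) ((B *m v) i 0).
Proof.
rewrite (_ : (fun y => _) = (fun y => \sum_j B i j *: y j 0) - cst (c i 0)).
  rewrite mxE -[X in is_derive _ _ _ X]subr0; apply: is_deriveB.
  by apply: is_derive_sum_pw => j; exact/is_deriveZ/is_derive_coord.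
by apply/funext => z; rewrite !mxE.
Qed.

Lemma differentiable_lsq y : differentiable (lsq A b) y.
Proof.
rewrite (_ : lsq A b = 2^-1 *: (fun y => \sum_i (fun y => (A *m y - b) i 0) y *
   (fun y => (A *m y - b) i 0) y)).
  apply: differentiableZ; apply: differentiable_sum_pw => i.
  by apply: differentiableM; exact: differentiable_mulmx.
by apply/funext => z; rewrite lsq_dotp.
Qed.

Lemma is_derive_lsq y v : is_derive y v (lsq A b) (dotp (lsq_grad y) v).
Proof.
rewrite (_ : lsq A b = 2^-1 *: (fun y => \sum_i (fun y => (A *m y - b) i 0) y *
   (fun y => (A *m y - b) i 0) y)).
  rewrite /lsq_grad dotp_trmx /dotp.
  set s := \sum_i _; have -> : s = 2^-1 *: \sum_i
      ((A *m y - b) i 0 *: (A *m v) i 0 + (A *m y - b) i 0 *: (A *m v) i 0).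
    rewrite /GRing.scale /= mulr_sumr; apply: eq_bigr => i _.
    by rewrite /GRing.scale /=; field.
  apply: is_deriveZ; apply: is_derive_sum_pw => i.
  by apply: is_deriveM; exact: is_derive_mulmx.
by apply/funext => z; rewrite lsq_dotp.
Qed.

Lemma grad_lsq y : grad (lsq A b) y = lsq_grad y.
Proof.
apply/colP => i; rewrite mxE.
by rewrite (@derive_val _ _ _ _ _ _ _ (is_derive_lsq y (delta_mx i 0))) dotp_delta.
Qed.

(** Strong smoothness between [h] and 0, compared with the exact expansion at 0: the affine parts
    cancel. *)
Lemma strongly_smooth_dotp s h : strongly_smooth s (lsq A b) ->
  dotp (A *m h) (A *m h) <= s * dotp h h.
Proof.
move=> /(_ h 0); rewrite subr0 grad_lsq -[X in lsq A b X](add0r h) lsqD sqr_enorm.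
by move=> H; lra.
Qed.

End LeastSquares.

(** * Gradient and generalized Hessian of E *)

Lemma convex_hull1 (R : realType) (M : lmodType R) (x : M) :
  convex_hull [set x] = [set x].
Proof.
apply: smallest_id => u v l; rewrite !inE => -> ->.
by rewrite /= convmm.
Qed.

Section RestrictedObjective.
Variables (R : realType) (m n : nat) (A : 'M[R]_(m, n)) (b : 'cV[R]_m).
Variables (lambda q : R).
Implicit Types (x y h v : 'cV[R]_n) (T : {set 'I_n}).

(** Closed forms of the gradient and, next, of the Hessian of [E] for a fixed [T]. They are proved
    to be the derivatives at points whose entries on [T] are nonzero. *)
Definition grad_E T y : 'cV[R]_n :=
  \col_i (lsq_grad A b y i 0
          + (if i \in T then lambda * dabspow q (y i 0) else 0)).

Definition hess_E T y : 'M[R]_n :=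
  \matrix_(i, j) ((A^T *m A) i j
     + (if (i == j) && (i \in T) then lambda * ddabspow q (y i 0) else 0)).

Definition nonzero_on T y := forall i, i \in T -> y i 0 != 0.

Lemma nonzero_on_supp y : nonzero_on (supp y) y.
Proof. by move=> i; rewrite inE. Qed.

Lemma near_nonzero_on T y : nonzero_on T y -> \forall z \near y, nonzero_on T z.
Proof.
move=> Ty; have H i : \forall z \near y, i \in T -> (z : 'cV[R]_n) i 0 != 0; last first.
  by apply: filter_forall H.
case: (boolP (i \in T)) => [iT|_]; last by near=> z.
have c : (fun z : 'cV[R]_n => z i 0) @ y --> y i 0 by exact: coord_continuous.
have := cvgr_neq0 _ c (Ty _ iT).
by move=> /(_ _); apply: filterS => z hz _.
Unshelve. all: by end_near. Qed.

Lemma qnorm_subvec T y :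
  qnorm q (subvec T y) = \sum_(i in T) abspow q (y i 0).
Proof.
rewrite big_enum_val; apply: eq_bigr => k _.
by rewrite mxE.
Qed.

Lemma E_sum T : E (lsq A b) lambda q T = lsq A b +
  lambda *: (fun y => \sum_i (if i \in T then abspow q \o (fun y => y i 0)
                              else cst 0) y).
Proof.
apply/funext => y; rewrite /E qnorm_subvec big_mkcond; congr (_ + _ * _).
by apply: eq_bigr => i _; case: ifP.
Qed.

Lemma differentiable_coord_comp (g : R -> R) i y a :
  is_derive (y i 0) (1 : R) g a -> differentiable (g \o (fun y => y i 0)) y.
Proof.
move=> [dg _]; apply: differentiable_comp; first exact: differentiable_coord.
exact/derivable1_diffP.
Qed.

Lemma differentiable_E T y : nonzero_on T y ->
  differentiable (E (lsq A b) lambda q T) y.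
Proof.
move=> Ty; rewrite E_sum; apply: differentiableD; first exact: differentiable_lsq.
apply: differentiableZ; apply: differentiable_sum_pw => i.
case: ifP => [iT|_]; last exact: differentiable_cst.
by apply: differentiable_coord_comp (is_derive_abspow q _); exact: Ty.
Qed.

Lemma is_derive_E T y v : nonzero_on T y ->
  is_derive y v (E (lsq A b) lambda q T) (dotp (grad_E T y) v).
Proof.
move=> Ty; rewrite E_sum.
have -> : dotp (grad_E T y) v = dotp (lsq_grad A b y) v + lambda *:
    \sum_i (if i \in T then dabspow q (y i 0) * v i 0 else 0).
  rewrite /GRing.scale /= mulr_sumr -big_split; apply: eq_bigr => i _.
  by rewrite mxE; case: ifP => _ /=; ring.
apply: is_deriveD; first exact: is_derive_lsq.
apply: is_deriveZ; apply: is_derive_sum_pw => i.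
case: ifP => [iT|_]; last exact: is_derive_cst.
apply: is_derive_comp; last exact: is_derive_coord.
  by apply: is_derive_abspow; exact: Ty.
exact: differentiable_coord.
Qed.

Lemma grad_EE T y : nonzero_on T y ->
  grad (E (lsq A b) lambda q T) y = grad_E T y.
Proof.
move=> Ty; apply/colP => i; rewrite mxE.
by rewrite (@derive_val _ _ _ _ _ _ _ (is_derive_E (delta_mx i 0) Ty)) dotp_delta.
Qed.

Let grad_E_coord T i y : grad_E T y i 0 = (((A^T *m A) *m y - A^T *m b) i 0 +
  (if i \in T then lambda *: (dabspow q \o (fun y => y i 0)) else cst 0) y).
Proof.
rewrite mxE /lsq_grad mulmxBr mulmxA; congr (_ + _).
by case: ifP.
Qed.

Lemma differentiable_grad_E_coord T i y : nonzero_on T y ->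
  differentiable (fun y => grad_E T y i 0) y.
Proof.
move=> Ty; rewrite (_ : (fun y => _) = (fun y => ((A^T *m A) *m y - A^T *m b) i 0)
   + (if i \in T then lambda *: (dabspow q \o (fun y => y i 0)) else cst 0));
  last by apply/funext => z; rewrite grad_E_coord.
apply: differentiableD; first exact: differentiable_mulmx.
case: ifP => [iT|_]; last exact: differentiable_cst.
apply: differentiableZ.
by apply: differentiable_coord_comp (is_derive_dabspow q _); exact: Ty.
Qed.

Lemma hess_E_mul T y v i : (hess_E T y *m v) i 0 = ((A^T *m A) *m v) i 0 +
  (if i \in T then lambda * (ddabspow q (y i 0) * v i 0) else 0).
Proof.
rewrite mxE (eq_bigr (fun j => (A^T *m A) i j * v j 0 + (if (i == j) && (i \in T)
   then lambda * ddabspow q (y i 0) else 0) * v j 0)); last first.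
  by move=> j _; rewrite [hess_E _ _ _ _]mxE mulrDl.
rewrite big_split /= [in RHS]mxE; congr (_ + _).
rewrite (bigD1 i) //= eqxx big1 ?addr0 /= => [|j ij].
  by case: ifP => _; rewrite ?mul0r // -mulrA.
by rewrite eq_sym (negbTE ij) mul0r.
Qed.

Lemma dotp_hess_E T y v : dotp (hess_E T y *m v) v = dotp (A *m v) (A *m v) +
  lambda * \sum_(i in T) ddabspow q (y i 0) * v i 0 ^+ 2.
Proof.
rewrite -(dotp_trmx A (A *m v) v) mulmxA big_mkcond mulr_sumr -big_split.
apply: eq_bigr => i _; rewrite hess_E_mul mulrDl; congr (_ + _).
by case: ifP => _ /=; ring.
Qed.

Lemma is_derive_grad_E_coord T i y v : nonzero_on T y ->
  is_derive y v (fun y => grad_E T y i 0) ((hess_E T y *m v) i 0).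
Proof.
move=> Ty; rewrite (_ : (fun y => _) = (fun y => ((A^T *m A) *m y - A^T *m b) i 0)
   + (if i \in T then lambda *: (dabspow q \o (fun y => y i 0)) else cst 0));
  last by apply/funext => z; rewrite grad_E_coord.
rewrite hess_E_mul.
apply: is_deriveD; first exact: is_derive_mulmx.
case: ifP => [iT|_]; last exact: is_derive_cst.
apply: is_deriveZ; apply: is_derive_comp; last exact: is_derive_coord.
  by apply: is_derive_dabspow; exact: Ty.
exact: differentiable_coord.
Qed.

Lemma near_grad_EE T y : nonzero_on T y ->
  \forall z \near y, grad_E T z = grad (E (lsq A b) lambda q T) z.
Proof.
by move=> Ty; apply: filterS (near_nonzero_on Ty) => z /grad_EE.
Qed.

Lemma hess_EE T y : nonzero_on T y ->
  hess (E (lsq A b) lambda q T) y = hess_E T y.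
Proof.
move=> Ty; apply/matrixP => i j; rewrite [LHS]mxE.
rewrite -(@near_eq_derive _ _ _ (fun z => grad_E T z i 0)); last first.
  by apply: filterS (near_grad_EE Ty) => z ->.
rewrite (@derive_val _ _ _ _ _ _ _ (is_derive_grad_E_coord i (delta_mx j 0) Ty)).
by rewrite -colE mxE.
Qed.

Lemma twice_differentiable_E T y : nonzero_on T y ->
  twice_differentiable (E (lsq A b) lambda q T) y.
Proof.
move=> Ty; split.
  by apply: filterS (near_nonzero_on Ty) => z /differentiable_E.
apply: near_eq_differentiable (near_grad_EE Ty) _.
rewrite (_ : grad_E T = fun y => \col_i (fun i y => grad_E T y i 0) i y).
  by apply: differentiable_col => i; exact: differentiable_grad_E_coord.
by apply/funext => z; apply/colP => i; rewrite [RHS]mxE.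
Qed.

(** Points close to [y] also have nonzero entries on [T], and the Hessian is continuous there, so
    all limits of Hessians coincide; the constant sequence attains the limit. The convex hull is
    that of a single point. *)
Lemma gen_hess_E T y : nonzero_on T y ->
  gen_hess (E (lsq A b) lambda q T) y = [set hess_E T y].
Proof.
move=> Ty; rewrite /gen_hess (_ : [set H | _] = [set hess_E T y]).
  exact: convex_hull1.
apply/seteqP; split=> [H [xs [_ xsy hH]]|_ ->] /=; last first.
  exists (cst y); split=> [k||]; first exact: twice_differentiable_E.
    exact: cvg_cst.
  rewrite -(hess_EE Ty). by apply: cvg_cst; exact: eventually_filter.
have xsT : \forall k \near \oo, nonzero_on T (xs k).
  exact: (xsy _ (near_nonzero_on Ty)).
apply/matrixP => i j.
have cH : (hess (E (lsq A b) lambda q T) (xs k) i j) @[k --> \oo] --> H i j.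
  exact: (cvg_comp _ _ hH (@coord_continuous _ _ _ i j H)).
have cD : (hess_E T (xs k) i j) @[k --> \oo] --> hess_E T y i j.
  rewrite mxE; under eq_fun do rewrite mxE.
  apply: cvgD; first exact: cvg_cst.
  case: ifP => [/andP[_ iT]|_]; last exact: cvg_cst.
  apply: cvgM; first exact: cvg_cst.
  apply: (cvg_comp (fun k => xs k i 0) (ddabspow q)).
    exact: (cvg_comp _ _ xsy (@coord_continuous _ _ _ i 0 y)).
  exact/continuous_ddabspow/Ty.
have cH' : hess_E T (xs k) i j @[k --> \oo] --> H i j.
  apply: cvg_trans cH; apply: near_eq_cvg.
  by apply: filterS xsT => k /hess_EE ->.
exact: (cvg_unique _ cH' cD).
Qed.

End RestrictedObjective.

(** * Newton equations as equations on vectors supported on T *)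

Section Subvectors.
Variables (R : realType) (n : nat).
Implicit Types (x y h d : 'cV[R]_n) (T : {set 'I_n}) (H : 'M[R]_n).

Definition supported T h := forall i, i \notin T -> h i 0 = 0.

Lemma supported_supp x : supported (supp x) x.
Proof. by move=> i; rewrite inE negbK => /eqP. Qed.

Lemma supportedD T x y : supported T x -> supported T y -> supported T (x + y).
Proof. by move=> Tx Ty i iT; rewrite mxE Tx // Ty // addr0. Qed.

Lemma supportedN T x : supported T x -> supported T (- x).
Proof. by move=> Tx i iT; rewrite mxE Tx // oppr0. Qed.

Lemma supportedB T x y : supported T x -> supported T y -> supported T (x - y).
Proof. by move=> Tx Ty; exact/supportedD/supportedN. Qed.

Lemma supportedZ T a x : supported T x -> supported T (a *: x).
Proof. by move=> Tx i iT; rewrite mxE Tx // mulr0. Qed.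

(** Extension by zero, written as a sum over positions so that indices outside [T] need no rank. *)
Definition extend T (v : 'cV[R]_#|T|) : 'cV[R]_n :=
  \col_i \sum_k (enum_val k == i)%:R * v k 0.

Lemma subvec_extend T (v : 'cV[R]_#|T|) : subvec T (extend v) = v.
Proof.
apply/colP => k; rewrite !mxE (bigD1 k) //= eqxx mul1r big1 ?addr0 // => l lk.
by rewrite (inj_eq enum_val_inj) (negbTE lk) mul0r.
Qed.

Lemma supported_extend T (v : 'cV[R]_#|T|) : supported T (extend v).
Proof.
move=> i iT; rewrite mxE big1 // => k _; case: eqP => [ki|_]; last by rewrite mul0r.
by move: iT; rewrite -ki enum_valP.
Qed.

Lemma subvecC_eq0 T d : subvec (~: T) d = 0 <-> supported T d.
Proof.
split=> [d0 i iT|Td].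
  have iT' : i \in ~: T by rewrite inE.
  move/colP: d0 => /(_ (enum_rank_in iT' i)).
  by rewrite !mxE enum_rankK_in.
apply/colP => k; rewrite !mxE; apply: Td.
by have := enum_valP k; rewrite inE.
Qed.

Lemma sum_supported T h (G : 'I_n -> R) : supported T h ->
  \sum_(k < #|T|) G (enum_val k) * h (enum_val k) 0 = \sum_i G i * h i 0.
Proof.
move=> Th; rewrite -(big_enum_val (fun i => G i * h i 0)).
rewrite [RHS](bigID (mem T)) /= [X in _ = _ + X]big1 ?addr0 //.
by move=> i /Th ->; rewrite mulr0.
Qed.

Lemma dotp_subvec T x y : supported T y ->
  dotp (subvec T x) (subvec T y) = dotp x y.
Proof.
move=> Ty; rewrite /dotp -(sum_supported (fun i => x i 0) Ty).
by apply: eq_bigr => k _; rewrite !mxE.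
Qed.

Lemma submat_mul T H h : supported T h ->
  submat T H *m subvec T h = subvec T (H *m h).
Proof.
move=> Th; apply/colP => k; rewrite !mxE -(sum_supported _ Th).
by apply: eq_bigr => l _; rewrite !mxE.
Qed.

Lemma dotp_submat T H (v : 'cV[R]_#|T|) :
  dotp (submat T H *m v) v = dotp (H *m extend v) (extend v).
Proof.
rewrite -{1 2}(subvec_extend v) submat_mul; last exact: supported_extend.
by rewrite dotp_subvec //; exact: supported_extend.
Qed.

Lemma extend_subvec T h : supported T h -> extend (subvec T h) = h.
Proof.
move=> Th; apply/colP => i; rewrite mxE.
have [iT|iT] := boolP (i \in T); last first.
  rewrite big1 ?Th // => k _; rewrite mxE.
  case: eqP => [ki|_]; last by rewrite mul0r.
  by move: iT; rewrite -ki enum_valP.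
rewrite (bigD1 (enum_rank_in iT i)) //= enum_rankK_in // eqxx mul1r mxE.
rewrite enum_rankK_in // big1 ?addr0 // => k.
rewrite -(inj_eq enum_val_inj) enum_rankK_in // => /negbTE ->.
by rewrite mul0r.
Qed.

(** If [M] were singular, a nonzero vector of its left kernel would make the quadratic form
    vanish. *)
Lemma mulmx_onto_of_definite p (M : 'M[R]_p) (u : 'cV[R]_p) :
  (forall v, v != 0 -> 0 < dotp (M *m v) v) -> exists v, M *m v = u.
Proof.
move=> Mpos; have Munit : M \in unitmx.
  rewrite unitmxE unitfE; apply/negP => /det0P[v vn0 vM].
  have vTn0 : v^T != 0 by rewrite -(inj_eq (@trmx_inj _ _ _)) trmxK trmx0.
  by have := Mpos _ vTn0; rewrite dotpC dotpE trmxK mulmxA vM mul0mx mxE ltxx.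
by exists (invmx M *m u); rewrite mulKVmx.
Qed.

End Subvectors.

(** * Generalized Hessian on the support, and the meaning of [sigma_star] *)

Section GeneralizedHessian.
Variables (R : realType) (m n : nat) (A : 'M[R]_(m, n)) (b : 'cV[R]_m).
Variables (lambda q sigma : R).
Implicit Types (x y w h d : 'cV[R]_n) (T : {set 'I_n}).

(** Every point has nonzero entries on its own support, so the matrix chosen by the algorithm is
    forced. *)
Lemma gen_hessS_E w : gen_hessS (lsq A b) lambda q w =
  [set submat (supp w) (hess_E A lambda q (supp w) w)].
Proof.
rewrite /gen_hessS (gen_hess_E _ _ _ _ (@nonzero_on_supp _ _ w)).
by rewrite image_set1.
Qed.

Lemma newton_directionP w d :
  newton_direction (lsq A b) lambda q w
    (submat (supp w) (hess_E A lambda q (supp w) w)) d <->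
  supported (supp w) d /\ forall i, i \in supp w ->
    (hess_E A lambda q (supp w) w *m d) i 0 = grad_E A b lambda q (supp w) w i 0.
Proof.
rewrite /newton_direction subvecC_eq0 /gradS grad_EE; last exact: nonzero_on_supp.
split=> [[e Td]|[Td e]]; split=> //.
  move=> i iT; move: e; rewrite submat_mul // => /colP /(_ (enum_rank_in iT i)).
  by rewrite [LHS]mxE [RHS]mxE enum_rankK_in.
rewrite submat_mul //; apply/colP => k; rewrite [LHS]mxE [RHS]mxE.
exact/e/enum_valP.
Qed.

Lemma newton_direction_exists w :
  (forall h, supported (supp w) h -> h != 0 ->
     0 < dotp (hess_E A lambda q (supp w) w *m h) h) ->
  exists d, newton_direction (lsq A b) lambda q w
    (submat (supp w) (hess_E A lambda q (supp w) w)) d.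
Proof.
move=> Hpos; set T := supp w; set H := hess_E _ _ _ _ _.
have [|v vE] := @mulmx_onto_of_definite _ _ (submat T H)
    (gradS (lsq A b) lambda q w).
  move=> v vn0; rewrite dotp_submat; apply: Hpos; first exact: supported_extend.
  apply: contraNneq vn0 => v0; rewrite -(subvec_extend v) v0.
  by apply/eqP/colP => k; rewrite !mxE.
exists (extend v); split; first by rewrite subvec_extend.
by apply/subvecC_eq0; exact: supported_extend.
Qed.

(** The outer infimum runs over one matrix; the inner one is tested on [h] scaled to unit length,
    which is why [h = 0] is set apart. The factor one half in [sigma_star] turns into
    [2 * sigma]. *)
Lemma sigma_star_coercive x h :
  (sigma%:E < sigma_star (lsq A b) lambda q x)%E -> supported (supp x) h ->
  2 * sigma * dotp h h <= dotp (hess_E A lambda q (supp x) x *m h) h.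
Proof.
rewrite /sigma_star gen_hessS_E image_set1 ereal_inf1 => + Th.
have [->|hn0] := eqVneq h 0.
  by move=> _; rewrite mulmx0 /dotp !big1 ?mulr0 // => i _; rewrite mxE mul0r.
set T := supp x; set H := hess_E _ _ _ _ _ => sigma_lt.
have D0 : 0 < dotp h h by rewrite lt_neqAle dotp_ge0 andbT eq_sym dotp_eq0.
have N0 : 0 < enorm h by rewrite sqrtr_gt0.
pose v := subvec T ((enorm h)^-1 *: h).
have Tv : supported T ((enorm h)^-1 *: h) by exact: supportedZ.
have v1 : enorm v = 1.
  rewrite /enorm dotp_subvec // dotpZl dotpZr -sqr_enorm.
  rewrite [X in Num.sqrt X](_ : _ = 1) ?sqrtr1 //.
  by field; rewrite gt_eqF.
have : (sigma%:E < (2^-1)%:E * (dotp (submat T H *m v) v)%:E)%E.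
  apply: lt_le_trans sigma_lt _; rewrite lee_pmul2l //.
  by apply: ereal_inf_lbound; exists v.
rewrite -EFinM lte_fin dotp_submat /v extend_subvec //.
rewrite -scalemxAr dotpZl dotpZr mulrA -invfM -expr2 sqr_enorm.
rewrite mulrCA -ltr_pdivrMl ?invr_gt0 // invrK mulrC => /ltW.
by rewrite -ler_pdivrMl // invrK mulrA.
Qed.

End GeneralizedHessian.

(** * Local model of F on vectors supported on T *)

Lemma supp_entries_bounded_below (R : realType) n (x : 'cV[R]_n) :
  exists2 r, 0 < r & forall i, i \in supp x -> 2 * r <= `|x i 0|.
Proof.
(* The default 1 keeps the minimum positive when the support is empty. *)
exists (2^-1 * \big[Num.min/1]_(i in supp x) `|x i 0|).
  rewrite mulr_gt0 ?invr_gt0 //; apply/bigmin_gtP; split=> // i.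
  by rewrite inE normr_gt0.
move=> i ix; rewrite mulVKf ?pnatr_eq0 //.
exact: bigmin_le_cond.
Qed.

Section LocalModel.
Variables (R : realType) (m n : nat) (A : 'M[R]_(m, n)) (b : 'cV[R]_m).
Variables (lambda q : R) (xs : 'cV[R]_n) (r : R).
Hypotheses (lambda_gt0 : 0 < lambda) (hq : 0 <= q < 1) (r_gt0 : 0 < r).
Hypothesis supp_r : forall i, i \in supp xs -> 2 * r <= `|xs i 0|.
Implicit Types (y z w h d : 'cV[R]_n).

Local Notation T := (supp xs).
Local Notation f := (lsq A b).
Local Notation Fq := (F f lambda q).
Local Notation g := (grad_E A b lambda q T).
Local Notation H := (hess_E A lambda q T).
Local Notation c := (lambda * abspow_cst q r).

Let c_ge0 : 0 <= c.
Proof. by rewrite mulr_ge0 ?abspow_cst_ge0 // ltW. Qed.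

Let near_coord i y : `|y - xs| < r / 2 -> `|y i 0 - xs i 0| < r / 2.
Proof. by apply: le_lt_trans; rewrite -coordB coord_le_norm. Qed.

Let near_ge y i : i \in T -> `|y - xs| < r / 2 -> r <= `|y i 0|.
Proof.
move=> /supp_r xr /(near_coord i) yx.
have := ler_normB (y i 0) (y i 0 - xs i 0).
rewrite [X in `|X|](_ : _ = xs i 0); last by ring.
by move: (normr_ge0 (y i 0)) => *; lra.
Qed.

(** The radius [r / 2] serves two ends: entries on [T] keep modulus at least [r], and two points of
    the ball differ by less than [r] in each entry. These are the hypotheses of the scalar Taylor
    bounds. *)
Let near_dist y z i : `|y - xs| < r / 2 -> `|z - xs| < r / 2 ->
  `|z i 0 - y i 0| < r.
Proof.
move=> /(near_coord i) yx /(near_coord i) zx.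
rewrite [X in `|X|](_ : _ = (z i 0 - xs i 0) - (y i 0 - xs i 0)); last by ring.
by apply: le_lt_trans (ler_normB _ _) _; lra.
Qed.

Lemma near_supp y : `|y - xs| < r / 2 -> supported T y -> supp y = T.
Proof.
move=> yx Ty; apply/setP => i; apply/idP/idP; last first.
  by move=> /near_ge /(_ yx) ry; rewrite inE -normr_gt0 (lt_le_trans r_gt0).
by apply: contraLR => /Ty yi; rewrite inE yi eqxx.
Qed.

Let FE y : supported T y -> Fq y = f y + lambda * \sum_(i in T) abspow q (y i 0).
Proof.
move=> Ty; congr (_ + _ * _); rewrite /qnorm [LHS](bigID (mem T)) /=.
by rewrite [X in _ + X]big1 ?addr0 // => i /Ty ->; rewrite abspow0.
Qed.

(** Only the entries on [T] leave a remainder. Each cubic term is at most the max norm of the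
    increment times the square of its entry, and the squares sum to the inner product. *)
Lemma F_taylor y z : `|y - xs| < r / 2 -> `|z - xs| < r / 2 ->
  supported T y -> supported T z ->
  `|Fq z - Fq y - dotp (g y) (z - y) - 2^-1 * dotp (H y *m (z - y)) (z - y)|
    <= c * `|z - y| * dotp (z - y) (z - y).
Proof.
move=> yx zx Ty Tz; rewrite !FE // dotp_hess_E.
set h := z - y; have zE : z = y + h by rewrite addrC subrK.
have -> : dotp (g y) h = dotp (lsq_grad A b y) h +
    lambda * \sum_(i in T) dabspow q (y i 0) * h i 0.
  rewrite [X in _ * X]big_mkcond mulr_sumr -big_split; apply: eq_bigr => i _.
  by rewrite mxE; case: ifP => _ /=; ring.
rewrite [in f z]zE lsqD.
set S1 := \sum_(i in T) abspow q (z i 0).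
set S2 := \sum_(i in T) abspow q (y i 0).
set S3 := \sum_(i in T) dabspow q (y i 0) * h i 0.
set S4 := \sum_(i in T) ddabspow q (y i 0) * h i 0 ^+ 2.
set l := (X in `|X|).
have {l} -> : l = lambda * (S1 - S2 - S3 - 2^-1 * S4) by rewrite /l; field.
rewrite normrM gtr0_norm // -2!(mulrA lambda) ler_pM2l // -(mulrA (abspow_cst q r)).
have -> : S1 - S2 - S3 - 2^-1 * S4 = \sum_(i in T)
    (abspow q (z i 0) - abspow q (y i 0) - dabspow q (y i 0) * (z i 0 - y i 0)
     - ddabspow q (y i 0) / 2 * (z i 0 - y i 0) ^+ 2).
  rewrite /S4 mulr_sumr -!sumrB; apply: eq_bigr => i _.
  by rewrite !mxE; field.
apply: le_trans (ler_norm_sum _ _ _) _.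
rewrite /dotp !mulr_sumr [leRHS](bigID (mem T)) /= -[leLHS]addr0.
apply: lerD; last first.
  apply: sumr_ge0 => i _.
  by rewrite mulr_ge0 ?abspow_cst_ge0 // mulr_ge0 // -expr2 sqr_ge0.
apply: ler_sum => i iT.
apply: le_trans (abspow_taylor hq r_gt0 (near_ge iT yx) (near_dist i yx zx)
  (near_ge iT zx)) _.
rewrite ler_wpM2l ?abspow_cst_ge0 // exprS -expr2 -[h i 0 ^+ 2]real_normK ?num_real //.
have -> : z i 0 - y i 0 = h i 0 by rewrite !mxE.
by rewrite ler_wpM2r ?sqr_ge0 // coord_le_norm.
Qed.

Lemma hess_E_lipschitz y h : `|y - xs| < r / 2 ->
  `|dotp (H y *m h) h - dotp (H xs *m h) h| <= c * `|y - xs| * dotp h h.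
Proof.
move=> yx; have xx : `|xs - xs| < r / 2 by rewrite subrr normr0 divr_gt0.
rewrite !dotp_hess_E opprD addrACA subrr add0r -mulrBr -sumrB.
rewrite normrM gtr0_norm // -2!(mulrA lambda) ler_pM2l // -(mulrA (abspow_cst q r)).
apply: le_trans (ler_norm_sum _ _ _) _.
rewrite /dotp !mulr_sumr [leRHS](bigID (mem T)) /= -[leLHS]addr0.
apply: lerD; last first.
  apply: sumr_ge0 => i _.
  by rewrite mulr_ge0 ?abspow_cst_ge0 // mulr_ge0 // -expr2 sqr_ge0.
apply: ler_sum => i iT; rewrite -mulrBl -expr2 normrM [`|_ ^+ 2|]ger0_norm ?sqr_ge0 //.
rewrite mulrA ler_wpM2r ?sqr_ge0 //.
apply: le_trans (ddabspow_lipschitz hq r_gt0 (near_ge iT xx) (near_dist i xx yx)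
  (near_ge iT yx)) _.
rewrite ler_wpM2l ?abspow_cst_ge0 //.
by have := coord_le_norm (y - xs) i; rewrite !mxE.
Qed.

(** The gradient of [f] is affine and the power part is separable, so the remainder in entry [i]
    involves that entry only. *)
Lemma grad_E_taylor y z i : i \in T -> `|y - xs| < r / 2 -> `|z - xs| < r / 2 ->
  `|g z i 0 - g y i 0 - (H y *m (z - y)) i 0| <= c * (z - y) i 0 ^+ 2.
Proof.
move=> iT yx zx; rewrite hess_E_mul [g z i 0]mxE [g y i 0]mxE iT.
set h := z - y; have zE : z = y + h by rewrite addrC subrK.
have -> : lsq_grad A b z i 0 = lsq_grad A b y i 0 + (A^T *m A *m h) i 0.
  by rewrite {1}zE lsq_gradD mxE.
rewrite [X in `|X|](_ : _ = lambda * (dabspow q (z i 0) - dabspow q (y i 0)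
  - ddabspow q (y i 0) * h i 0)); last by ring.
rewrite normrM gtr0_norm // -mulrA ler_pM2l //.
have -> : h i 0 = z i 0 - y i 0 by rewrite !mxE.
exact: dabspow_taylor (near_ge iT yx) (near_dist i yx zx) (near_ge iT zx).
Qed.

Section Stationary.
Variables (sigma : R).
Hypothesis sigma_gt0 : 0 < sigma.
Hypothesis stat : forall i, i \in T -> g xs i 0 = 0.
Hypothesis coercive : forall h, supported T h ->
  2 * sigma * dotp h h <= dotp (H xs *m h) h.

Let xx : `|xs - xs| < r / 2.
Proof. by rewrite subrr normr0 divr_gt0. Qed.

Let dotp_g0 h : supported T h -> dotp (g xs) h = 0.
Proof.
move=> Th; rewrite /dotp big1 // => i _.
by have [/stat ->|/Th ->] := boolP (i \in T); rewrite ?mul0r ?mulr0.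
Qed.

Let Txs : supported T xs := @supported_supp _ _ xs.

(** Stationarity removes the linear term; half the Hessian gives [sigma], of which the cubic
    remainder consumes at most [sigma / 2]. *)
Lemma quadratic_growth y : `|y - xs| < r / 2 -> supported T y ->
  c * `|y - xs| <= sigma / 2 ->
  sigma / 2 * dotp (y - xs) (y - xs) <= Fq y - Fq xs.
Proof.
move=> yx Ty cy; have Th := supportedB Ty Txs.
have := F_taylor xx yx Txs Ty; rewrite dotp_g0 // subr0 ler_norml => /andP[+ _].
have := coercive Th; have := ler_wpM2r (dotp_ge0 (y - xs)) cy.
by move=> *; lra.
Qed.

(** The power is concave on each side of 0, so it only lowers the Hessian below that of [f], which
    [sigma0] bounds. *)
Lemma quadratic_upper_bound sigma0 y : strongly_smooth sigma0 f ->
  `|y - xs| < r / 2 -> supported T y -> c * `|y - xs| <= sigma / 2 ->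
  Fq y - Fq xs <= (sigma0 + sigma) / 2 * dotp (y - xs) (y - xs).
Proof.
move=> smooth yx Ty cy; have Th := supportedB Ty Txs.
have := F_taylor xx yx Txs Ty; rewrite dotp_g0 // subr0 ler_norml => /andP[_].
have := strongly_smooth_dotp (y - xs) smooth.
have := ler_wpM2r (dotp_ge0 (y - xs)) cy.
have : dotp (H xs *m (y - xs)) (y - xs) <= dotp (A *m (y - xs)) (A *m (y - xs)).
  rewrite dotp_hess_E gerDl; apply: mulr_ge0_le0; first exact: ltW.
  apply: sumr_le0 => i _; apply: mulr_le0_ge0; last exact: sqr_ge0.
  exact: ddabspow_le0.
by move=> *; lra.
Qed.

Lemma hess_E_coercive w h : `|w - xs| < r / 2 -> c * `|w - xs| <= sigma / 2 ->
  supported T h -> 3 / 2 * sigma * dotp h h <= dotp (H w *m h) h.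
Proof.
move=> wx cw Th; have := hess_E_lipschitz h wx; rewrite ler_norml => /andP[+ _].
have := coercive Th; have := ler_wpM2r (dotp_ge0 h) cw.
by move=> *; lra.
Qed.

(** As the gradient vanishes on [T] at [xs], applying the Hessian at [w] to the new error yields the
    Taylor remainder of the gradient between [w] and [xs]. Pairing with the error and using
    coercivity gives the bound times the length of the error, which is then divided out. *)
Lemma newton_error w d : `|w - xs| < r / 2 -> c * `|w - xs| <= sigma / 2 ->
  supported T w -> supported T d ->
  (forall i, i \in T -> (H w *m d) i 0 = g w i 0) ->
  3 / 2 * sigma * enorm (w - d - xs) <= c * dotp (w - xs) (w - xs).
Proof.
move=> wx cw Tw Td Hd; set e := w - d - xs.
have Te : supported T e by apply: supportedB => //; exact: supportedB.
have [->|en0] := eqVneq (enorm e) 0.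
  by rewrite mulr0 mulr_ge0 ?dotp_ge0.
have e0 : 0 < enorm e by rewrite lt_neqAle eq_sym en0 enorm_ge0.
have coord i : i \in T -> `|(H w *m e) i 0| <= c * (w - xs) i 0 ^+ 2.
  move=> iT; have := grad_E_taylor iT wx xx; rewrite stat // sub0r.
  have -> : (H w *m e) i 0 = - g w i 0 - (H w *m (xs - w)) i 0.
    have -> : e = - d - (xs - w) by rewrite opprB addrCA addrA.
    by rewrite -(Hd i iT) mulmxBr mulmxN coordB coordN.
  by rewrite -[xs - w]opprB coordN sqrrN.
have := hess_E_coercive wx cw Te.
rewrite -[X in _ * X <= _]sqr_enorm expr2 mulrA => le1.
rewrite -(ler_pM2r e0); apply: le_trans le1 _.
apply: le_trans (ler_norm _) _; apply: le_trans (ler_norm_sum _ _ _) _.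
rewrite [c * _]mulr_sumr mulr_suml; apply: ler_sum => i _; rewrite normrM.
have [iT|iT] := boolP (i \in T); last first.
  by rewrite (Te _ iT) normr0 mulr0 mulr_ge0 ?enorm_ge0 // -expr2 mulr_ge0 ?sqr_ge0.
rewrite -expr2; apply: ler_pM => //; first exact: coord.
by rewrite -sqrtr_sqr ler_wsqrtr // sqr_coord_le_dotp.
Qed.

(** By the Newton equations the linear term is minus twice the quadratic one. What remains is at
    most [- 3/4 sigma] from coercivity plus [sigma / 4] from the cubic remainder, times the squared
    length of [d]. *)
Lemma newton_decrease w d : `|w - xs| < r / 2 -> c * `|w - xs| <= sigma / 2 ->
  `|w - d - xs| < r / 2 -> c * `|d| <= sigma / 4 ->
  supported T w -> supported T d ->
  (forall i, i \in T -> (H w *m d) i 0 = g w i 0) ->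
  Fq (w - d) <= Fq w - sigma / 2 * dotp d d.
Proof.
move=> wx cw wdx cd Tw Td Hd.
have := F_taylor wx wdx Tw (supportedB Tw Td).
have -> : w - d - w = - d by rewrite addrAC subrr add0r.
rewrite mulmxN !dotpNr !dotpNl normrN !opprK.
have -> : dotp (g w) d = dotp (H w *m d) d.
  apply: eq_bigr => i _.
  by have [/Hd ->|/Td ->] := boolP (i \in T); rewrite ?mulr0.
have := hess_E_coercive wx cw Td; have := ler_wpM2r (dotp_ge0 d) cd.
rewrite ler_norml => + + /andP[_ +].
by move=> *; lra.
Qed.

End Stationary.

End LocalModel.

(** * Proximal points and stationarity *)

Lemma near_norm_lt (R : realType) (V : normedModType R) (x : V) (e : R) :
  0 < e -> \forall y \near x, `|y - x| < e.
Proof.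
move=> e0; have := nbhsx_ballx x e e0; rewrite -ball_normE.
by apply: filterS => y /=; rewrite distrC.
Qed.

Section Proximal.
Variables (R : realType) (n : nat).
Implicit Types (x y z w : 'cV[R]_n).

(** The proximal problem is separable: compare [w] with the vector that differs from it in entry [i]
    only. *)
Lemma Prox_coord (c q : R) z w i t : Prox (fun v => c * qnorm q v) z w ->
  2^-1 * (z i 0 - w i 0) ^+ 2 + c * abspow q (w i 0)
  <= 2^-1 * (z i 0 - t) ^+ 2 + c * abspow q t.
Proof.
pose v := \col_j if j == i then t else w j 0.
move=> /(_ v); rewrite !sqr_enorm /dotp /qnorm.
rewrite (bigD1 i) //= [in X in _ + X <= _](bigD1 i) //=.
rewrite [in X in _ <= X + _](bigD1 i) //= [in X in _ <= _ + X](bigD1 i) //=.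
rewrite (eq_bigr (fun j => (z - w) j 0 * (z - w) j 0)
  (F1 := fun j => (z - v) j 0 * (z - v) j 0)); last first.
  by move=> j /negbTE ji; rewrite !mxE ji.
rewrite (eq_bigr (fun j => abspow q (w j 0)) (F1 := fun j => abspow q (v j 0)));
  last by move=> j /negbTE ji; rewrite !mxE ji.
rewrite -!expr2 !coordB.
have -> : v i 0 = t by rewrite mxE eqxx.
by move=> H; lra.
Qed.

Lemma Prox_stationary (c q : R) z w i : Prox (fun v => c * qnorm q v) z w ->
  w i 0 != 0 -> w i 0 - z i 0 + c * dabspow q (w i 0) = 0.
Proof.
move=> /(@Prox_coord _ _ _ _ i) wmin wi0.
pose G (t : R) := 2^-1 * (z i 0 - t) ^+ 2 + c * abspow q t.
have dG (t : R) : t != 0 -> is_derive t 1 G (t - z i 0 + c * dabspow q t).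
  move=> t0; have h := is_derive_abspow q t0.
  have h1 : is_derive t 1 (fun t => 2^-1 * (z i 0 - t) ^+ 2) (t - z i 0).
    apply: is_derive_eq.
    by rewrite /GRing.scale /=; field.
  exact: (is_deriveD h1 (is_deriveZ c h)).
(* The largest open interval centred at the entry that avoids 0; Fermat's rule applies there. *)
pose a := w i 0 - `|w i 0|; pose b := w i 0 + `|w i 0|.
have w0 : 0 < `|w i 0| by rewrite normr_gt0.
have win : w i 0 \in `]a, b[ by rewrite in_itv /= /a /b gtrBl ltrDl w0.
have der (t : R) : t \in `]a, b[ -> derivable G t 1.
  rewrite in_itv /= => /andP[t1 t2]; have t0 : t != 0; last by have [] := dG _ t0.
  apply/negP => /eqP tE; move: t1 t2; rewrite tE /a /b.
  by case: (ltgtP (w i 0) 0) wi0 => // wi _; [rewrite ltr0_norm|rewrite gtr0_norm];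
    lra.
have ab : a <= b by rewrite /a /b; lra.
have [_ /= d0] := @derive1_at_min R G a b (w i 0) ab der win (fun t _ => wmin t).
by have [_ <-] := dG _ wi0; rewrite d0.
Qed.

End Proximal.

Section NearLimit.
Variables (R : realType) (m n : nat) (A : 'M[R]_(m, n)) (b : 'cV[R]_m).
Variables (lambda q : R) (xs : 'cV[R]_n).
Hypotheses (lambda_gt0 : 0 < lambda) (hq : 0 <= q < 1).
Implicit Types (x y z w : 'cV[R]_n).

Local Notation T := (supp xs).
Local Notation f := (lsq A b).
Local Notation Fq := (F f lambda q).

Lemma lsq_grad_bounded : exists2 L, 0 <= L &
  forall x i, `|x - xs| < 1 -> `|lsq_grad A b x i 0| <= L.
Proof.
have [K K0 HK] := mulmx_norm_bound (A^T *m A).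
exists (`|lsq_grad A b xs| + K) => [|x i x1]; first by rewrite addr_ge0.
have -> : x = xs + (x - xs) by rewrite addrC subrK.
rewrite lsq_gradD mxE; apply: le_trans (ler_normD _ _) _.
apply: lerD; first exact: coord_le_norm.
by apply: le_trans (HK _ _) _; rewrite ler_piMr // ltW.
Qed.

Definition prox_point alpha x w :=
  Prox (fun v => alpha * lambda * qnorm q v) (x - alpha *: lsq_grad A b x) w.

(** Entries on [T] cannot vanish so close to [xs]. Off [T], a nonzero entry of [w] would be small,
    and comparing it with 0 in the proximal problem contradicts [abspow_dominates]. *)
Lemma Prox_near_supp alpha : 0 < alpha ->
  exists2 rho, 0 < rho & forall x w, `|x - xs| < rho -> `|w - xs| < rho ->
    prox_point alpha x w -> supp w = T.
Proof.
move=> alpha0; have [L L0 HL] := lsq_grad_bounded.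
have [r r0 supp_r] := supp_entries_bounded_below xs.
have al0 : 0 < alpha * lambda by rewrite mulr_gt0.
(* The numerator bounds every entry of the gradient step when [x] is within distance 1 of [xs]. *)
have [c c0 Hc] := abspow_dominates ((`|xs| + 1 + alpha * L) / (alpha * lambda)) hq.
exists (Num.min 1 (Num.min c r)) => [|x w]; first by rewrite !lt_min ltr01 c0.
rewrite !lt_min => /and3P[x1 _ _] /and3P[w1 wc wr] wprox.
apply/setP => i; have wi := coord_le_norm (w - xs) i; rewrite coordB in wi.
have [iT|iT] := boolP (i \in T).
  rewrite inE; apply/negP => /eqP wi0; have := supp_r _ iT.
  by move: wi; rewrite wi0 sub0r normrN => *; lra.
rewrite inE; apply/negP => /negP wi0.
have xsi : xs i 0 = 0 by exact: supported_supp iT.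
have wic : `|w i 0| < c by move: wi; rewrite xsi subr0; lra.
have := Hc _ wi0 wic; apply/negP; rewrite -leNgt mulrAC ler_pdivlMr //.
have := @Prox_coord _ _ _ _ _ _ i 0 wprox.
rewrite abspow0 mulr0 addr0 subr0 coordB mxE.
set z := x i 0 - _ => Hz.
have zb : `|z| <= `|xs| + 1 + alpha * L.
  apply: le_trans (ler_normB _ _) _; apply: lerD.
    have -> : x = xs + (x - xs) by rewrite addrC subrK.
    apply: le_trans (coord_le_norm _ _) _; apply: le_trans (ler_normD _ _) _.
    by rewrite lerD2l ltW.
  by rewrite normrM gtr0_norm // ler_pM2l // HL.
rewrite mulrC; apply: (@le_trans _ _ (`|z| * `|w i 0|)); last by rewrite ler_wpM2r.
rewrite -normrM; apply: le_trans (ler_norm _).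
have := sqr_ge0 (w i 0); move: Hz; rewrite !expr2 => *; lra.
Qed.

Lemma Prox_limit_stationary alpha : 0 < alpha ->
  (forall rho, 0 < rho -> exists x w, [/\ `|x - xs| < rho, `|w - xs| < rho
     & prox_point alpha x w]) ->
  forall i, i \in T -> grad_E A b lambda q T xs i 0 = 0.
Proof.
move=> alpha0 Hx i iT.
have xsi0 : xs i 0 != 0 by move: iT; rewrite inE.
have [r r0 supp_r] := supp_entries_bounded_below xs.
have [K K0 HK] := mulmx_norm_bound (A^T *m A).
pose C := `|ddabspow q (xs i 0)| + abspow_cst q r * r.
have C0 : 0 <= C by rewrite addr_ge0 // mulr_ge0 ?abspow_cst_ge0 // ltW.
set G := grad_E _ _ _ _ _ _ _ _.
(* The three sources of error: variation of the gradient of [f], variation of [dabspow] with local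
   Lipschitz constant [C], and the distances of [x] and [w] to [xs]. *)
pose B := alpha * K + alpha * lambda * C + 2.
have B0 : 0 < B.
  by rewrite ltr_pwDr // addr_ge0 // !mulr_ge0 // ltW.
suff HG (e : R) : 0 < e -> e < r -> `|alpha * G| <= B * e.
  apply/eqP/negPn/negP => Gn0.
  have G0 : 0 < `|alpha * G|
    by rewrite normr_gt0; apply: mulf_neq0 => //; exact: lt0r_neq0.
  (* With this radius a nonzero [alpha * G] would be at most half of itself in modulus. *)
  pose e := Num.min (r / 2) (`|alpha * G| / (2 * B)).
  have e0 : 0 < e by rewrite lt_min !divr_gt0 // mulr_gt0.
  have er : e < r by rewrite gt_min; apply/orP; left; lra.
  have := HG e e0 er; apply/negP; rewrite -ltNge.
  apply: (@le_lt_trans _ _ (B * (`|alpha * G| / (2 * B)))).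
    by rewrite ler_pM2l // ge_min lexx orbT.
  rewrite [X in X < _](_ : _ = `|alpha * G| / 2); first lra.
  by field; rewrite gt_eqF.
move=> e0 er; have [x [w [xe we wprox]]] := Hx e e0.
have wi := coord_le_norm (w - xs) i; rewrite coordB in wi.
have xi := coord_le_norm (x - xs) i; rewrite coordB in xi.
have xsr := supp_r _ iT.
have wr : r <= `|w i 0|.
  have := ler_normB (w i 0) (w i 0 - xs i 0).
  rewrite [X in `|X|](_ : _ = xs i 0); last by ring.
  by move: (normr_ge0 (w i 0)) => *; lra.
have wi0 : w i 0 != 0 by rewrite -normr_gt0 (lt_le_trans r0).
have := Prox_stationary wprox wi0; rewrite coordB mxE => st.
have GE : G = lsq_grad A b xs i 0 + lambda * dabspow q (xs i 0).
  by rewrite /G mxE iT.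
have gE : lsq_grad A b x i 0 = lsq_grad A b xs i 0 + (A^T *m A *m (x - xs)) i 0.
  by rewrite -[in LHS](subrK xs x) addrC lsq_gradD mxE.
set S := (A^T *m A *m (x - xs)) i 0 in gE.
(* The optimality condition of the proximal point, rewritten as its deviation from the condition at
   [xs]. *)
have -> : alpha * G = - alpha * S
    - alpha * lambda * (dabspow q (w i 0) - dabspow q (xs i 0))
    - (w i 0 - xs i 0) + (x i 0 - xs i 0).
  by rewrite gE in st; rewrite GE; lra.
have Sb : `|S| <= K * e.
  by apply: le_trans (HK _ _) _; rewrite ler_wpM2l // ltW.
have Db : `|dabspow q (w i 0) - dabspow q (xs i 0)| <= C * e.
  have wxr : `|w i 0 - xs i 0| < r by lra.
  have := dabspow_taylor hq r0 (_ : r <= `|xs i 0|) wxr wr.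
  move=> /(_ _) H; have {}H := H ltac:(lra).
  move: H; set D := dabspow _ _ - _; set X := ddabspow _ _ * _ => H.
  have DX : `|D| <= `|D - X| + `|X| by rewrite -[D in leLHS](subrK X) ler_normD.
  have Xe : `|X| <= `|ddabspow q (xs i 0)| * e.
    by rewrite normrM ler_wpM2l // (le_trans wi) // ltW.
  have He : abspow_cst q r * (w i 0 - xs i 0) ^+ 2 <= abspow_cst q r * (r * e).
    rewrite ler_wpM2l ?abspow_cst_ge0 // -real_normK ?num_real // expr2.
    by apply: ler_pM => //; lra.
  by rewrite /C mulrDl; lra.
rewrite /B !mulrDl.
apply: le_trans (ler_normD _ _) _.
have := ler_normB (- alpha * S - alpha * lambda * (dabspow q (w i 0)
  - dabspow q (xs i 0))) (w i 0 - xs i 0).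
have := ler_normB (- alpha * S)
  (alpha * lambda * (dabspow q (w i 0) - dabspow q (xs i 0))).
rewrite !normrM normrN !(gtr0_norm alpha0) (gtr0_norm lambda_gt0).
have := ler_wpM2l (ltW alpha0) Sb.
have := ler_wpM2l (ltW (mulr_gt0 alpha0 lambda_gt0)) Db.
by move=> *; lra.
Qed.

(** Split a nearby [x] into its part [y] on [T] and the rest [u]. Growth handles [y], domination of
    linear terms handles [u], and orthogonality adds the squared lengths. *)
Lemma local_minimizer_of_growth sigma : 0 < sigma ->
  (exists2 rho, 0 < rho & forall y, `|y - xs| < rho -> supported T y ->
     sigma * dotp (y - xs) (y - xs) <= Fq y - Fq xs) ->
  unique_local_minimizer f lambda q xs.
Proof.
move=> sigma0 [rho rho0 growth].
have [L L0 HL] := lsq_grad_bounded.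
(* Here [L] pays for the gradient term, and the extra 1 leaves the modulus of the entry, which
   exceeds its square below 1. *)
have [c c0 Hc] := abspow_dominates ((L + 1) / lambda) hq.
exists (Num.min sigma 1); first by rewrite lt_min sigma0 ltr01.
have : \forall x \near xs, `|x - xs| < Num.min 1 (Num.min c rho).
  by apply: near_norm_lt; rewrite !lt_min ltr01 c0.
apply: filterS => x; rewrite !lt_min => /and3P[x1 xc xrho].
pose y := \col_i if i \in T then x i 0 else 0.
pose u := x - y.
have Ty : supported T y by move=> i /negbTE iT; rewrite mxE iT.
have uT i : i \in T -> u i 0 = 0 by move=> iT; rewrite !mxE iT subrr.
have uNT i : i \notin T -> u i 0 = x i 0.
  by move=> /negbTE iT; rewrite !mxE iT subr0.
have xNT i : i \notin T -> `|x i 0| <= `|x - xs|.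
  move=> iT; have := coord_le_norm (x - xs) i.
  by rewrite coordB (supported_supp iT) subr0.
have yxs : `|y - xs| <= `|x - xs|.
  apply: norm_le => // i; rewrite coordB mxE.
  have [iT|iT] := boolP (i \in T); first by rewrite -coordB coord_le_norm.
  by rewrite (supported_supp iT) subr0 normr0.
have orth : dotp (x - xs) (x - xs) = dotp (y - xs) (y - xs) + dotp u u.
  have -> : x - xs = (y - xs) + u by rewrite /u [RHS]addrC addrA subrK.
  have orth0 : dotp (y - xs) u = 0.
    apply: big1 => i _; have [/uT ->|iT] := boolP (i \in T); first by rewrite mulr0.
    by rewrite coordB Ty // (supported_supp iT) subr0 mul0r.
  by rewrite dotp_sqrD orth0 mulr0 addr0.
have Fy := growth y (le_lt_trans yxs xrho) Ty.
have Fx : dotp u u <= Fq x - Fq y.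
  have -> : Fq x - Fq y = dotp (lsq_grad A b y) u + 2^-1 * dotp (A *m u) (A *m u)
     + lambda * (\sum_i (abspow q (x i 0) - abspow q (y i 0))).
    have xE : x = y + u by rewrite /u subrKC.
    rewrite /F sumrB /qnorm [in f x]xE.
    by rewrite lsqD; ring.
  have := dotp_ge0 (A *m u); set Q := dotp (A *m u) _.
  suff : dotp u u <= dotp (lsq_grad A b y) u
     + lambda * (\sum_i (abspow q (x i 0) - abspow q (y i 0))) by lra.
  rewrite mulr_sumr -big_split; apply: ler_sum => i _ /=.
  have [iT|iT] := boolP (i \in T).
    by rewrite uT // !mulr0 mxE iT subrr mulr0 addr0.
  rewrite uNT // Ty // abspow0 subr0.
  have [->|xi0] := eqVneq (x i 0) 0; first by rewrite abspow0 !mulr0 addr0.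
  have := Hc _ xi0 (le_lt_trans (xNT _ iT) xc).
  rewrite mulrAC ltr_pdivrMr // [_ * lambda]mulrC.
  have xi1 : `|x i 0| < 1 by exact: le_lt_trans (xNT _ iT) x1.
  have : x i 0 * x i 0 <= `|x i 0|.
    by rewrite -expr2 -real_normK ?num_real // expr2 ler_piMr // ltW.
  have := HL y i (le_lt_trans yxs x1).
  have := ler_norm (- (lsq_grad A b y i 0 * x i 0)); rewrite normrN normrM => h1 h2.
  have := ler_wpM2r (normr_ge0 (x i 0)) h2.
  by move=> *; lra.
rewrite sqr_enorm orth mulrDr.
have : Num.min sigma 1 * dotp (y - xs) (y - xs) <= sigma * dotp (y - xs) (y - xs).
  by rewrite ler_wpM2r ?dotp_ge0 // ge_min lexx.
have : Num.min sigma 1 * dotp u u <= 1 * dotp u u.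
  by rewrite ler_wpM2r ?dotp_ge0 // ge_min lexx orbT.
by move=> *; lra.
Qed.

End NearLimit.

(** * Convergence of the iterates *)

Section NewtonStep.
Variables (R : realType) (m n : nat) (A : 'M[R]_(m, n)) (b : 'cV[R]_m).
Variables (lambda q sigma gamma : R).
Implicit Types (x y w d : 'cV[R]_n).

Local Notation f := (lsq A b).
Local Notation Fq := (F f lambda q).

Lemma F_ge0 x : 0 < lambda -> 0 <= Fq x.
Proof.
move=> lambda0; rewrite addr_ge0 ?lsq_ge0 // mulr_ge0 ?(ltW lambda0) //.
by apply: sumr_ge0 => i _; exact: abspow_ge0.
Qed.

Lemma newton_step_decrease w x' : newton_step f lambda q sigma gamma w x' ->
  sigma / 2 * dotp (x' - w) (x' - w) <= Fq w - Fq x'.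
Proof.
case=> M _ [[d [s [_ dec _ ->]]]|[_ ->]|[d [_ _ ->]]].
- by rewrite addrAC subrr add0r dotpNl dotpNr opprK -sqr_enorm lerBrDr -lerBrDl.
- by rewrite !subrr /dotp big1 ?mulr0 // => i _; rewrite mxE mul0r.
- by rewrite !subrr /dotp big1 ?mulr0 // => i _; rewrite mxE mul0r.
Qed.

Lemma newton_step_supported w x' : newton_step f lambda q sigma gamma w x' ->
  supported (supp w) x'.
Proof.
case=> M _ [[d [s [[_ /subvecC_eq0 Td] _ _ ->]]]|[_ ->]|[d [_ _ ->]]].
- by apply: supportedB; [exact: supported_supp|exact: supportedZ].
- exact: supported_supp.
- exact: supported_supp.
Qed.

(** Near [xs] the Newton system is solvable and its full step is accepted, so both fallbacks are
    impossible and minimality forces [s = 0]. In [n.+1], the part [n] pays for passing from the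
    Euclidean to the max norm, and the part 1 bounds the Lipschitz term itself. *)
Lemma newton_step_full xs r w x' :
  0 < lambda -> 0 <= q < 1 -> 0 < sigma -> 0 < r ->
  (forall i, i \in supp xs -> 2 * r <= `|xs i 0|) ->
  (forall i, i \in supp xs -> grad_E A b lambda q (supp xs) xs i 0 = 0) ->
  (forall h, supported (supp xs) h ->
     2 * sigma * dotp h h <= dotp (hess_E A lambda q (supp xs) xs *m h) h) ->
  `|w - xs| < r / 2 ->
  lambda * abspow_cst q r * n.+1%:R * `|w - xs| <= sigma / 8 ->
  supp w = supp xs -> newton_step f lambda q sigma gamma w x' ->
  3 / 2 * sigma * enorm (x' - xs)
    <= lambda * abspow_cst q r * dotp (w - xs) (w - xs).
Proof.
move=> lambda0 hq sigma0 r0 supp_r stat coercive wx cw wT.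
set c := lambda * abspow_cst q r in cw *.
have c0 : 0 <= c by rewrite mulr_ge0 ?abspow_cst_ge0 // ltW.
have N0 := normr_ge0 (w - xs).
have cN0 : 0 <= c * `|w - xs| by rewrite mulr_ge0.
have cnN0 : 0 <= c * n%:R * `|w - xs| by rewrite mulr_ge0 // mulr_ge0 // ler0n.
have cwE : c * n.+1%:R * `|w - xs| = c * n%:R * `|w - xs| + c * `|w - xs|.
  by rewrite -natr1; ring.
have cw2 : c * `|w - xs| <= sigma / 2 by lra.
have Tw : supported (supp xs) w by rewrite -wT; exact: supported_supp.
have full d : newton_direction f lambda q w
    (submat (supp w) (hess_E A lambda q (supp w) w)) d ->
    sufficient_decrease f lambda q sigma gamma w d 0 /\
    3 / 2 * sigma * enorm (w - d - xs) <= c * dotp (w - xs) (w - xs).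
  move=> /newton_directionP; rewrite wT => -[Td Hd].
  have err := newton_error lambda0 hq r0 supp_r stat coercive wx cw2 Tw Td Hd.
  split=> //; rewrite /sufficient_decrease expr0 scale1r sqr_enorm.
  (* The full step does not leave the ball, and [d] is at most twice as long as [w - xs]; hence the
     bound [sigma / 8] for [w] becomes the [sigma / 4] required for [d]. *)
  have eN : `|w - d - xs| <= `|w - xs|.
    have D1 : c * dotp (w - xs) (w - xs) <= sigma * `|w - xs|.
      apply: (@le_trans _ _ (c * (n%:R * `|w - xs| ^+ 2))).
        by rewrite ler_wpM2l // dotp_le_sqr_norm.
      rewrite expr2 !mulrA ler_wpM2r //; lra.
    have D2 : `|w - d - xs| <= enorm (w - d - xs).
      apply: norm_le => [|i]; first exact: enorm_ge0.
      by rewrite -sqrtr_sqr ler_wsqrtr // sqr_coord_le_dotp.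
    apply: le_trans D2 _; rewrite -(ler_pM2l sigma0); apply: le_trans D1.
    apply: le_trans err; rewrite -mulrA ler_peMl ?mulr_ge0 ?enorm_ge0 ?(ltW sigma0) //.
    lra.
  apply: (newton_decrease lambda0 hq r0 supp_r coercive wx cw2 _ _ Tw Td Hd).
    exact: le_lt_trans wx.
  have dE : d = (w - xs) - (w - d - xs).
    by apply/colP => i; rewrite !mxE; ring.
  have : `|d| <= 2 * `|w - xs|.
    by rewrite [in leLHS]dE; apply: le_trans (ler_normB _ _) _; lra.
  by move=> /(ler_wpM2l c0) H; rewrite -/c; lra.
case=> M; rewrite gen_hessS_E => -> [[d [s [/full[dec0 err] _ /(_ 0 dec0)]]]||].
- by rewrite leqn0 => /eqP -> ->; rewrite expr0 scale1r.
- case=> nodir _; exfalso.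
  have [|d /nodir //] := @newton_direction_exists _ _ _ A b lambda q w.
  move=> h Th hn0; apply: lt_le_trans (_ : 3 / 2 * sigma * dotp h h <= _).
    rewrite mulr_gt0 //; first by lra.
    by rewrite lt_neqAle eq_sym dotp_eq0 hn0 dotp_ge0.
  rewrite wT in Th *.
  exact: (hess_E_coercive lambda0 hq r0 supp_r coercive wx cw2 Th).
- by case=> d [/full[dec0 _] /(_ 0)].
Qed.

End NewtonStep.

(** * Monotone sequences, shifted indices and cluster points *)

Lemma nonincreasing_steps_vanish (R : realType) (v : nat -> R) (e : R) :
  (forall k, v k.+1 <= v k) -> (forall k, 0 <= v k) -> 0 < e ->
  \forall k \near \oo, v k - v k.+1 < e.
Proof.
move=> vdec v0 e0.
have vcvg : cvgn v.
  apply: nonincreasing_is_cvgn; first exact/nonincreasing_seqP.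
  by exists 0 => _ [k _ <-].
have : (v k - v k.+1) @[k --> \oo] --> lim (v @ \oo) - lim (v @ \oo).
  by apply: cvgB => //; rewrite (cvg_shiftS v).
rewrite subrr => /cvgrPdist_lt /(_ e e0); apply: filterS => k.
by rewrite sub0r normrN; apply: le_lt_trans; exact: ler_norm.
Qed.

Lemma near_infty_shift (P : nat -> Prop) :
  (\forall k \near \oo, P k) -> \forall k \near \oo, P k.+1.
Proof. by case=> N _ HN; exists N => // k /= Nk; apply: HN => /=; exact: leqW. Qed.

Lemma near_infty_unshift (P : nat -> Prop) :
  (\forall k \near \oo, P k.+1) -> \forall k \near \oo, P k.
Proof. by case=> N _ HN; exists N.+1 => // -[//|k] /= Nk; exact: HN. Qed.

(** The values of the sequence at indices satisfying [P] form a set of the filter, so every ball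
    around a cluster point meets it. *)
Lemma cluster_frequently (R : realType) (V : normedModType R) (x : nat -> V)
    (xs : V) (P : nat -> Prop) (e : R) :
  cluster (x k @[k --> \oo]) xs -> 0 < e -> (\forall k \near \oo, P k) ->
  exists2 k, P k & `|x k - xs| < e.
Proof.
move=> clx e0 HP.
have [|_ [[k Pk <-] xk]] := clx [set y | exists2 k, P k & x k = y]
    [set y | `|y - xs| < e] _ (near_norm_lt xs e0); last by exists k.
by apply: filterS HP => k Pk; exists k.
Qed.

Section Iteration.
Variables (R : realType) (m n : nat) (A : 'M[R]_(m, n)) (b : 'cV[R]_m).
Variables (lambda q sigma gamma alpha : R).

Local Notation f := (lsq A b).
Local Notation Fq := (F f lambda q).

(* Holds for the steps of both PSNP and PCSNP, which differ only when the
   support changes. *)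
Record iteration (x w : 'cV[R]_n) (x' : 'cV[R]_n) : Prop := Iteration {
  iteration_prox : prox_point A b lambda q alpha x w;
  iteration_prox_decrease : sigma / 4 * dotp (w - x) (w - x) <= Fq x - Fq w;
  iteration_step : supp w = supp x -> newton_step f lambda q sigma gamma w x';
  iteration_step_decrease : sigma / 2 * dotp (x' - w) (x' - w) <= Fq w - Fq x';
  iteration_supported : supported (supp w) x' }.

(** Choice turns the proximal points into a sequence. When the support changes in PCSNP, the new
    iterate is [w] and the Newton clause is vacuous. *)
Lemma iterationP (x : nat -> 'cV[R]_n) :
  PSNP f lambda q sigma gamma (fun=> alpha) x \/
  PCSNP f lambda q sigma gamma (fun=> alpha) x ->
  exists w, forall k, iteration (x k) (w k) (x k.+1).
Proof.
move=> hx; suff /choice : forall k, exists w, iteration (x k) w (x k.+1).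
  by case=> w hw; exists w.
move=> k.
have prox w : prox_step f lambda q alpha sigma (x k) w ->
    prox_point A b lambda q alpha (x k) w /\
    sigma / 4 * dotp (w - x k) (w - x k) <= Fq (x k) - Fq w.
  by rewrite /prox_step grad_lsq sqr_enorm => -[? ?]; split=> //; lra.
case: hx => /(_ k) [w /prox[wprox dec]].
  move=> st; exists w; split=> //; first exact: newton_step_decrease st.
  exact: newton_step_supported st.
case: ifPn => [/eqP _ st|/eqP sw ->]; exists w; split=> //.
- exact: newton_step_decrease st.
- exact: newton_step_supported st.
- by rewrite !subrr /dotp big1 ?mulr0 // => i _; rewrite mxE mul0r.
- exact: supported_supp.
Qed.

End Iteration.

Theorem corollary4p2 (R : realType) (m n : nat)
    (A : 'M[R]_(m, n)) (b : 'cV[R]_m)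
    (lambda q sigma0 tau sigma gamma alpha : R)
    (x : nat -> 'cV[R]_n) (xstar : 'cV[R]_n)
    (hlambda : 0 < lambda) (hq : 0 <= q < 1)
    (hsigma0 : 0 < sigma0) (hsmooth : strongly_smooth sigma0 (lsq A b))
    (htau : 0 < tau) (hsigma : 0 < sigma) (hgamma : 0 < gamma < 1)
    (halpha : 0 < alpha <= Num.min tau (1 / (sigma + sigma0)))
    (hgrad0 : grad (lsq A b) 0 != 0)
    (hlambda_lt :
      lambda < alpha `^ (1 - q) / 2 * `|grad (lsq A b) 0| `^ (2 - q))
    (hx : PSNP (lsq A b) lambda q sigma gamma (fun=> alpha) x \/
          PCSNP (lsq A b) lambda q sigma gamma (fun=> alpha) x)
    (hxstar : cluster (x k @[k --> \oo]) xstar)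
    (hpos : forall M, gen_hessS (lsq A b) lambda q xstar M ->
       forall v : 'cV[R]_#|supp xstar|, v != 0 -> 0 < dotp (M *m v) v)
    (hsigma_lt : (sigma%:E < sigma_star (lsq A b) lambda q xstar)%E) :
  [/\ x k @[k --> \oo] --> xstar,
      unique_local_minimizer (lsq A b) lambda q xstar,
      q = 0 -> \forall k \near \oo, x k = xstar
    & 0 < q ->
      (fun k => enorm (x k.+1 - xstar)) =O_\oo
      (fun k => enorm (x k - xstar) ^+ 2)].
Proof.
have alpha0 : 0 < alpha by case/andP: halpha.
have [w hw] := iterationP hx.
pose Fq := F (lsq A b) lambda q; pose T := supp xstar.
have coercive h := sigma_star_coercive (h := h) hsigma_lt.
have [r r0 supp_r] := supp_entries_bounded_below xstar.
have [rho rho0 prox_supp] := Prox_near_supp A b xstar hlambda hq alpha0.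
set c := lambda * abspow_cst q r.
have c0 : 0 <= c by rewrite mulr_ge0 ?abspow_cst_ge0 // ltW.
have cn0 : 0 <= c * n.+1%:R by rewrite mulr_ge0.
(* Adding 1 allows division by [P] even when [c = 0], as happens for [q = 0]. *)
have [P P0 PE] : exists2 P, 0 < P & P = c * n.+1%:R + 1.
  by exists (c * n.+1%:R + 1) => //; lra.
(* The three radii serve the Taylor bounds, the identification of the support and the smallness
   condition of [newton_step_full]. *)
pose delta := Num.min (r / 2) (Num.min rho (sigma / (8 * P))).
have delta0 : 0 < delta.
  by rewrite !lt_min !divr_gt0 ?rho0 // mulr_gt0.
have delta_r y : `|y - xstar| < delta -> `|y - xstar| < r / 2.
  by rewrite lt_min => /andP[].
have delta_rho y : `|y - xstar| < delta -> `|y - xstar| < rho.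
  by rewrite !lt_min => /and3P[].
have delta_cn y : `|y - xstar| < delta -> c * n.+1%:R * `|y - xstar| <= sigma / 8.
  rewrite !lt_min => /and3P[_ _ yd].
  apply: (@le_trans _ _ (P * `|y - xstar|)).
    by rewrite PE ler_wpM2r // lerDl.
  have -> : sigma / 8 = P * (sigma / (8 * P)) by field; rewrite gt_eqF.
  by rewrite ler_pM2l // ltW.
have delta_c y : `|y - xstar| < delta -> c * `|y - xstar| <= sigma / 2.
  move=> /delta_cn H; apply: (@le_trans _ _ (c * n.+1%:R * `|y - xstar|)); last by lra.
  by rewrite ler_wpM2r // ler_peMr // ler1n.
have Fdec k : Fq (x k.+1) <= Fq (x k).
  have := iteration_prox_decrease (hw k); have := iteration_step_decrease (hw k).
  have := dotp_ge0 (w k - x k); have := dotp_ge0 (x k.+1 - w k).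
  move=> /(mulr_ge0 (ltW hsigma)) ? /(mulr_ge0 (ltW hsigma)) ? *.
  by rewrite /Fq; lra.
have Fw k : Fq (w k) <= Fq (x k).
  have := iteration_prox_decrease (hw k).
  by have := mulr_ge0 (ltW hsigma) (dotp_ge0 (w k - x k)); rewrite /Fq; lra.
have Fw' k : Fq (x k.+1) <= Fq (w k).
  have := iteration_step_decrease (hw k).
  by have := mulr_ge0 (ltW hsigma) (dotp_ge0 (x k.+1 - w k)); rewrite /Fq; lra.
(* Both half-steps lower F by a multiple of their squared length, while F is nonnegative. *)
have small_steps (e : R) : 0 < e -> \forall k \near \oo,
    `|w k - x k| < e /\ `|x k.+1 - w k| < e.
  move=> e0; have se0 : 0 < sigma / 4 * e ^+ 2 by rewrite !mulr_gt0 ?exprn_gt0.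
  have := nonincreasing_steps_vanish Fdec (fun k => F_ge0 A b q (x k) hlambda) se0.
  apply: filterS => k Fk.
  split; apply: norm_lt_dotp => //.
    have s4 : 0 < sigma / 4 by lra.
    rewrite -(ltr_pM2l s4); apply: le_lt_trans (iteration_prox_decrease (hw k)) _.
    by apply: le_lt_trans Fk; rewrite lerD2l lerN2.
  have s2 : 0 < sigma / 2 by lra.
  rewrite -(ltr_pM2l s2); apply: le_lt_trans (iteration_step_decrease (hw k)) _.
  apply: (@le_lt_trans _ _ (Fq (x k) - Fq (x k.+1))); first by rewrite lerD2r.
  by apply: lt_trans Fk _; have := exprn_gt0 2 e0; nra.
have stat i : i \in T -> grad_E A b lambda q T xstar i 0 = 0.
  apply: Prox_limit_stationary alpha0 _ i => // e e0.
  have e2 : 0 < e / 2 by lra.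
  have [k [wk _] xk] := cluster_frequently hxstar e2 (small_steps _ e2).
  exists (x k), (w k); split; [lra| |exact: (iteration_prox (hw k))].
  rewrite -(subrK (x k) (w k)) -addrA.
  by apply: le_lt_trans (ler_normD _ _) _; lra.
have wT k : `|x k - xstar| < delta -> `|w k - xstar| < delta -> supp (w k) = T.
  move=> /delta_rho xk /delta_rho wk.
  exact: prox_supp xk wk (iteration_prox (hw k)).
have Tw k : supp (w k) = T -> supported T (w k).
  by move=> <-; exact: supported_supp.
have growth y : `|y - xstar| < delta -> supported T y ->
    sigma / 2 * dotp (y - xstar) (y - xstar) <= Fq y - Fq xstar.
  move=> yd Ty.
  exact: (quadratic_growth hlambda hq r0 supp_r stat coercive
    (delta_r _ yd) Ty (delta_c _ yd)).
have upper y : `|y - xstar| < delta -> supported T y ->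
    Fq y - Fq xstar <= (sigma0 + sigma) / 2 * dotp (y - xstar) (y - xstar).
  move=> yd Ty.
  exact: (quadratic_upper_bound hlambda hq r0 supp_r stat hsmooth
    (delta_r _ yd) Ty (delta_c _ yd)).
have close k e : 0 < e -> `|x k - xstar| < e / 2 -> `|w k - x k| < e / 2 ->
    `|w k - xstar| < e.
  move=> e0 xk wk; rewrite -(subrK (x k) (w k)) -addrA.
  by apply: le_lt_trans (ler_normD _ _) _; lra.
(* The values F (x k) decrease to F xstar: along indices where x k is close to
   xstar, w k is close to xstar and supported on T, where F is smooth. *)
have Flim (e : R) : 0 < e -> \forall k \near \oo, Fq (x k) <= Fq xstar + e.
  (* Within distance 1, [K] times the distance bounds the excess of F over its value at [xstar]. *)
  move=> e0; pose K := (sigma0 + sigma) / 2 * n%:R + 1.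
  have K0 : 0 < K by rewrite ltr_wpDl // mulr_ge0 //; lra.
  pose d := Num.min delta (Num.min 1 (e / K)).
  have d0 : 0 < d by rewrite lt_min delta0 lt_min ltr01 divr_gt0.
  have d2 : 0 < d / 2 by lra.
  have [k [wk _] xk] := cluster_frequently hxstar d2 (small_steps _ d2).
  have wd := close k d d0 xk wk.
  have dd : d <= delta by rewrite ge_min lexx.
  have wdelta := lt_le_trans wd dd.
  have xdelta : `|x k - xstar| < delta by apply: lt_le_trans dd; lra.
  have Tk := Tw k (wT k xdelta wdelta).
  have Fk : Fq (w k) <= Fq xstar + e.
    rewrite -lerBlDl; apply: le_trans (upper _ wdelta Tk) _.
    move: wd; rewrite lt_min => /andP[_]; rewrite lt_min => /andP[w1 we].
    have s0 : 0 <= (sigma0 + sigma) / 2 by lra.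
    apply: le_trans (ler_wpM2l s0 (dotp_le_sqr_norm _)) _.
    rewrite mulrA; apply: (@le_trans _ _ (K * `|w k - xstar|)); last first.
      by rewrite mulrC -ler_pdivlMr // ltW.
    apply: (@le_trans _ _ ((sigma0 + sigma) / 2 * n%:R * `|w k - xstar|)).
      apply: ler_wpM2l; first by rewrite mulr_ge0.
      by rewrite expr2 ler_piMr // ltW.
    by rewrite ler_wpM2r // lerDl.
  exists k.+1 => // j /= kj; apply: le_trans Fk; apply: le_trans (Fw' k).
  by rewrite -(subnKC kj); elim: (j - k.+1)%N => [|i IH]; rewrite ?addn0 // addnS;
    exact: le_trans (Fdec _) IH.
(* Once the steps and F (x k) - F xstar are small, quadratic growth at w k
   keeps the iterates from leaving a small ball around xstar. *)
have trapped (e : R) : 0 < e -> e <= delta / 2 ->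
    \forall k \near \oo, `|x k - xstar| < e.
  move=> e0 ed; have e2 : 0 < e / 2 by lra.
  (* This excess of F is below [sigma / 2 * (e / 2) ^+ 2], so growth puts [w k] within [e / 2], and
     the next half-step adds less than [e / 2]. *)
  have se0 : 0 < sigma / 4 * (e / 2) ^+ 2 by rewrite !mulr_gt0 ?exprn_gt0.
  have [N _ HN] := filterI (small_steps _ e2) (Flim _ se0).
  have stay k : (N <= k)%N -> `|x k - xstar| < e -> `|x k.+1 - xstar| < e.
    move=> /HN /= [[wk xk'] Fk] xk.
    have wd : `|w k - xstar| < delta by apply: close => //; lra.
    have xd : `|x k - xstar| < delta by lra.
    have Tk := Tw k (wT k xd wd).
    have we : `|w k - xstar| < e / 2.
      apply: norm_lt_dotp => //; have s2 : 0 < sigma / 2 by lra.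
      rewrite -(ltr_pM2l s2); apply: le_lt_trans (growth _ wd Tk) _.
      rewrite ltrBlDl; apply: le_lt_trans (Fw k) _; apply: le_lt_trans Fk _.
      by rewrite ltrD2l ltr_pM2r ?exprn_gt0 //; lra.
    rewrite -(subrK (w k) (x k.+1)) -addrA.
    by apply: le_lt_trans (ler_normD _ _) _; lra.
  have HN' : \forall k \near \oo, (N <= k)%N by exists N.
  have [k Nk xk] := cluster_frequently hxstar e0 HN'.
  exists k => // j /= kj; rewrite -(subnKC kj).
  elim: (j - k)%N => [|i IH]; first by rewrite addn0.
  by rewrite addnS; apply: stay IH; rewrite (leq_trans Nk) // leq_addr.
have xcvg (e : R) : 0 < e -> \forall k \near \oo, `|x k - xstar| < e.
  move=> e0; have : 0 < Num.min e (delta / 2) by rewrite lt_min e0 /=; lra.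
  move=> /trapped; rewrite ge_min lexx orbT => /(_ isT).
  by apply: filterS => k; rewrite lt_min => /andP[].
have wcvg (e : R) : 0 < e -> \forall k \near \oo, `|w k - xstar| < e.
  move=> e0; have e2 : 0 < e / 2 by lra.
  apply: filterS (filterI (xcvg _ e2) (small_steps _ e2)) => k [xk [wk _]].
  exact: close.
have near_delta : \forall k \near \oo,
    `|x k - xstar| < delta /\ `|w k - xstar| < delta.
  exact: filterI (xcvg _ delta0) (wcvg _ delta0).
(* Each new iterate is supported on the support of [w k], which is [T], and is too close to [xstar]
   to lose an entry. From then on PCSNP also tries the Newton step. *)
have xT : \forall k \near \oo, supp (x k) = T.
  apply: near_infty_unshift.
  apply: filterS (filterI near_delta (near_infty_shift (xcvg _ delta0))).
  move=> k [[xk wk] xk'].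
  apply: (near_supp r0 supp_r); first exact: delta_r.
  by have := iteration_supported (hw k); rewrite (wT k xk wk).
have newton_rate : \forall k \near \oo, 3 / 2 * sigma * enorm (x k.+1 - xstar)
    <= c * dotp (w k - xstar) (w k - xstar).
  apply: filterS (filterI near_delta xT) => k [[xk wk] xkT].
  have wkT := wT k xk wk.
  have st := iteration_step (hw k) (etrans wkT (esym xkT)).
  exact: (newton_step_full hlambda hq hsigma r0 supp_r stat coercive
    (delta_r _ wk) (delta_cn _ wk) wkT st).
split.
- apply/cvgrPdist_lt => e e0; apply: filterS (xcvg _ e0) => k.
  by rewrite distrC.
- have s2 : 0 < sigma / 2 by lra.
  by apply: (local_minimizer_of_growth hlambda hq s2); exists delta.
- move=> q0; apply: near_infty_unshift; apply: filterS newton_rate => k.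
  rewrite /c /abspow_cst q0 !mul0r normr0 mul0r mulr0 mul0r => xk.
  apply/eqP; rewrite -subr_eq0 -dotp_eq0 -sqr_enorm expf_eq0 /=.
  rewrite eq_le enorm_ge0 andbT; have s3 : 0 < 3 / 2 * sigma by lra.
  by rewrite -(ler_pM2l s3) mulr0.
- move=> q0; apply/eqO_exP.
  (* The Newton rate combined with the ratio of the upper bound at [x k] to the growth bound at
     [w k]; the added 1 makes the constant positive. *)
  pose K := c * ((sigma0 + sigma) / sigma) / (3 / 2 * sigma) + 1.
  have s3 : 0 < 3 / 2 * sigma by lra.
  have K0 : 0 < K.
    by rewrite ltr_wpDl // divr_ge0 ?(ltW s3) // mulr_ge0 // divr_ge0 //; lra.
  exists K => //.
  apply: filterS (filterI (filterI near_delta xT) newton_rate).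
  move=> k [[[xk wk] xkT] rate].
  have Txk : supported T (x k) by rewrite -xkT; exact: supported_supp.
  have g := growth _ wk (Tw k (wT k xk wk)).
  have u := upper _ xk Txk.
  have Dw : dotp (w k - xstar) (w k - xstar) <=
      (sigma0 + sigma) / sigma * dotp (x k - xstar) (x k - xstar).
    have s2 : 0 < sigma / 2 by lra.
    rewrite -(ler_pM2l s2); apply: le_trans g _.
    apply: le_trans (lerB (Fw k) (lexx _)) _; apply: le_trans u _.
    by rewrite le_eqVlt; apply/orP; left; apply/eqP; field; rewrite gt_eqF.
  rewrite ger0_norm ?enorm_ge0 // ger0_norm ?sqr_ge0 // sqr_enorm.
  apply: (@le_trans _ _ (c * ((sigma0 + sigma) / sigma) / (3 / 2 * sigma) *
      dotp (x k - xstar) (x k - xstar))); last first.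
    by rewrite ler_wpM2r ?dotp_ge0 // lerDl.
  rewrite mulrAC ler_pdivlMr // mulrC; apply: le_trans rate _.
  by rewrite -(mulrA c) ler_wpM2l.
Qed.
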